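(* Let $A\in\mathbb{R}^{m\times n}$ ($m<n$) and $M\in\mathbb{R}^{m\times q}$ ($m\le q$) with $\mathrm{rank}(A)=\mathrm{rank}(M)=m$, let $y\in\mathbb{R}^m$ and $\tau>0$ be given, and let $\phi$ be a norm on $\mathbb{R}^q$ with $\phi(\mathbf e_i)=\phi^*(\mathbf e_i)=1$ for $i=1,\dots,q$. Consider the problem $$(\mathrm{P})\qquad\min_x\{\|x\|_1:\ \phi(M^T(Ax-y))\le\tau\}.$$ Let $\delta\in(0,\tau)$ be a fixed constant and let $\mathcal Q_{\epsilon_{j_0}}$ be a fixed polytope from the family $\{\mathcal Q_{\epsilon_j}\}$ defined in the context such that $d^{\mathcal H}(S^*,S_{\epsilon_{j_0}})\le\delta$. Suppose that $A^T$ satisfies the weak RSP of order $k$. Then for any $x\in\mathbb{R}^n$ there is an optimal solution $x^*$ of $(\mathrm{P})$ with $$\|x-x^*\|_2\le\delta+2\overline\gamma\left\{\widehat n\left(\phi(M^T(Ax-y))-\tau\right)^++2\sigma_k(x)_1+c\tau+c\,\phi(M^T(Ax-y))\right\},$$ where $\widehat n$ is the number of columns of $\Gamma_{\mathcal Q_{\epsilon_{j_0}}}$, $$c=\max_{G\subseteq\{1,\dots,q\},\,|G|=m}\{\|M_G^{-1}(AA^T)^{-1}A\|_{\infty\to1}:\ M_G\in\mathbb{R}^{m\times m}\text{ is an invertible submatrix of }M\},$$ and $\overline\gamma=\sigma_{\infty,2}(\overline M^1,\overline M^2)$ is the Robinson's constant of the pair $(\overline M^1,\overline M^2)$ defined in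 the context. Moreover, for any $x$ satisfying the constraint of $(\mathrm{P})$ there is an optimal solution $x^*$ of $(\mathrm{P})$ with $$\|x-x^*\|_2\le\delta+2\overline\gamma\{2\sigma_k(x)_1+c\tau+c\,\phi(M^T(Ax-y))\}\le\delta+4\overline\gamma\{\sigma_k(x)_1+c\tau\}.$$
   Context: Notation: $\mathbf e_i$ are the standard basis vectors of $\mathbb{R}^q$; $\phi^*(u)=\max_{\phi(x)\le1}u^Tx$ is the dual norm; $(s)^+=\max\{s,0\}$; $\sigma_k(x)_1=\inf_u\{\|x-u\|_1:\|u\|_0\le k\}$, where $\|u\|_0$ is the number of nonzero entries; $M_G$ is the submatrix of $M$ consisting of columns indexed by $G$; $\|Q\|_{\infty\to1}=\max_{\|x\|_\infty\le1}\|Qx\|_1$; $d^{\mathcal H}(\Omega_1,\Omega_2)=\max\{\sup_{u\in\Omega_1}\inf_{z\in\Omega_2}\|u-z\|_2,\ \sup_{z\in\Omega_2}\inf_{u\in\Omega_1}\|u-z\|_2\}$ is the Hausdorff distance. Weak RSP of order $k$ of $A^T$: for any disjoint $S_1,S_2\subseteq\{1,\dots,n\}$ with $|S_1|+|S_2|\le k$ there exists $\zeta\in\mathcal{R}(A^T)$ (the range of $A^T$) with $\zeta_i=1$ for $i\in S_1$, $\zeta_i=-1$ for $i\in S_2$, and $|\zeta_i|\le1$ for $i\notin S_1\cup S_2$. Polytopes $\mathcal Q_{\epsilon_j}$: let $\mathfrak B^\phi=\{x\in\mathbb{R}^q:\phi(x)\le1\}$. Fix $\chi>e/(4\sqrt2)$.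 By a theorem of Barvinok there is $\epsilon_0=\epsilon_0(\chi)>0$ such that for each $0<\epsilon<\epsilon_0$ there is a symmetric polytope $P_\epsilon\subset\mathbb{R}^q$ with at most $\left(\frac{\chi}{\sqrt\epsilon}\ln\frac1\epsilon\right)^q$ vertices and $P_\epsilon\subseteq\mathfrak B^\phi\subseteq(1+\epsilon)P_\epsilon$; fix such $P_\epsilon$. Shifting each facet hyperplane of $(1+\epsilon)P_\epsilon$ in parallel toward $\mathfrak B^\phi$ until it touches $\mathfrak B^\phi$ gives a polytope $\widehat P_\epsilon=\bigcap_{i=1}^J\{x:(a^i)^Tx\le1\}$, where the $a^i$ are the outer facet normals of $(1+\epsilon)P_\epsilon$ scaled so that $\phi^*(a^i)=1$. Put $\overline P_\epsilon=\widehat P_\epsilon\cap\{z\in\mathbb{R}^q:\ \mathbf e_i^Tz\le1,\ -\mathbf e_i^Tz\le1,\ i=1,\dots,q\}$. Fix a strictly decreasing positive sequence $\epsilon_k\in(0,\epsilon_0)$ with $\epsilon_k\to0$, and set $\mathcal Q_{\epsilon_j}=\bigcap_{k=1}^j\overline P_{\epsilon_k}$. Then $P_{\epsilon_j}\subseteq\mathfrak B^\phi\subseteq\mathcal Q_{\epsilon_j}\subseteq(1+\epsilon_j)P_{\epsilon_j}$. Let $\mathcal Y(\Gamma_{\mathcal Q_{\epsilon_j}})$ be the finite set of all vectors $a$ (each with $\phi^*(a)=1$) defining the half-spaces $a^Tz\le1$ in this construction of $\mathcal Q_{\epsilon_j}$ (including $\pm\mathbf e_i$), and $\Gamma_{\mathcal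 Q_{\epsilon_j}}$ the matrix with these vectors as columns, so that $\mathcal Q_{\epsilon_j}=\{z:(\Gamma_{\mathcal Q_{\epsilon_j}})^Tz\le\text{vector of ones}\}$. Solution set and relaxations: let $\varrho^*$ be the optimal value of $(\mathrm P)$, $S^*=\{x\in\mathbb{R}^n:\|x\|_1\le\varrho^*,\ \phi(M^T(Ax-y))\le\tau\}$ its set of optimal solutions, and $S_{\epsilon_j}=\{x\in\mathbb{R}^n:\|x\|_1\le\varrho^*,\ M^T(Ax-y)/\tau\in\mathcal Q_{\epsilon_j}\}$. (One has $d^{\mathcal H}(S^*,S_{\epsilon_j})\to0$ as $j\to\infty$, so a $j_0$ as required exists.) Robinson's constant: for $M'\in\mathbb{R}^{p_1\times r}$, $M''\in\mathbb{R}^{p_2\times r}$ let $$\mu_{\alpha_1,\alpha_2}(M',M'')=\max_{(d',d'')\in\mathcal F,\ \|(d',d'')\|_{\alpha_2}\le1}\ \min_{u\in\mathbb{R}^r}\{\|u\|_{\alpha_1}:\ M'u\le d',\ M''u=d''\},$$ with $\mathcal F=\{(d',d''):\ M'u\le d',\ M''u=d''\text{ for some }u\in\mathbb{R}^r\}$ (this is a finite number). For $N^1\in\mathbb{R}^{m_1\times\ell}$, $N^2\in\mathbb{R}^{m_2\times\ell}$, $$\sigma_{\alpha_1,\alpha_2}(N^1,N^2)=\max_{S\subseteq\{1,\dots,m_1\}}\mu_{\alpha_1,\alpha_2}\left(\begin{bmatrix}I_S&0\\-I&0\end{bmatrix},\begin{bmatrix}N^1\\N^2\end{bmatrix}^T\right),$$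 where $I$ is the $m_1\times m_1$ identity, $I_S$ consists of the rows of $I$ indexed by $S$, and the first matrix has $m_1+m_2$ columns. The matrices $\overline M^1,\overline M^2$: write $\Gamma=\Gamma_{\mathcal Q_{\epsilon_{j_0}}}\in\mathbb{R}^{q\times\widehat n}$; $\widetilde{\mathbf e}\in\mathbb{R}^n$, $\widehat{\mathbf e}\in\mathbb{R}^{\widehat n}$ are vectors of ones, $I$ is the $n\times n$ and $\widehat I$ the $\widehat n\times\widehat n$ identity; block columns have sizes $n,n,n,n,\widehat n$: $$\overline M^1=\begin{bmatrix} I&-I&0&0&0\\ -I&-I&0&0&0\\ 0&0&I&I&0\\ (M\Gamma)^TA&0&0&0&0\\ 0&-I&0&0&0\\ 0&0&-I&0&0\\ 0&0&0&-I&0\\ 0&0&0&0&-\widehat I \end{bmatrix},\qquad \overline M^2=\begin{bmatrix} 0&0&I&-I&A^TM\Gamma\\ 0&\widetilde{\mathbf e}^T&0&0&\tau\widehat{\mathbf e}^T+y^TM\Gamma \end{bmatrix}.$$ *)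

(* Defs.v *)
From HB Require Import structures.
From mathcomp Require Import all_boot all_order all_algebra.
From mathcomp Require Import finmap.
From mathcomp Require Import all_classical all_reals all_analysis.
Import numFieldNormedType.Exports.
Import Order.TTheory GRing.Theory Num.Theory.

Set Implicit Arguments.
Unset Strict Implicit.
Unset Printing Implicit Defensive.

Local Open Scope classical_set_scope.
Local Open Scope ring_scope.

(* Vectors of R^n are column vectors.  The norm `|x| that MathComp-Analysis   *)
(* puts on matrices is the max norm, hence on 'cV[R]_n it is the l_infinity   *)
(* norm.  Quantities written max / min in the mathematics are sup / inf of    *)
(* real sets below; each of these extrema is attained in the situations where *)
(* they are used.                                                             *)

Section Vectors.
Variable R : realType.

Definition dotv n (u v : 'cV[R]_n) : R := (u^T *m v) 0 0.

Definition stdvec n (i : 'I_n) : 'cV[R]_n := delta_mx i 0.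

Definition l1norm n (x : 'cV[R]_n) : R := \sum_i `|x i 0|.

Definition l2norm n (x : 'cV[R]_n) : R := Num.sqrt (\sum_i x i 0 ^+ 2).

Definition linfnorm n (x : 'cV[R]_n) : R := `|x|.

Definition l0norm n (x : 'cV[R]_n) : nat := #|[set i | x i 0 != 0]%SET|.

Definition le_vec n (u v : 'cV[R]_n) : Prop := forall i, u i 0 <= v i 0.

(* Nonnegativity and phi 0 = 0 are consequences.                              *)
Definition is_norm n (phi : 'cV[R]_n -> R) : Prop :=
  [/\ forall x, phi x = 0 -> x = 0,
      forall (a : R) x, phi (a *: x) = `|a| * phi x
    & forall x z, phi (x + z) <= phi x + phi z].

Definition unit_ball n (phi : 'cV[R]_n -> R) : set 'cV[R]_n :=
  [set x | phi x <= 1].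

Definition dual_norm n (phi : 'cV[R]_n -> R) (u : 'cV[R]_n) : R :=
  sup [set dotv u x | x in unit_ball phi].

(* sigma_k(x)_1                                                               *)
Definition best_kterm_err n (k : nat) (x : 'cV[R]_n) : R :=
  inf [set l1norm (x - u) | u in [set u : 'cV[R]_n | (l0norm u <= k)%N]].

Definition norm_inf_to_1 p n (Q : 'M[R]_(p, n)) : R :=
  sup [set l1norm (Q *m x) | x in [set x : 'cV[R]_n | linfnorm x <= 1]].

(* Extended-real valued, so that the suprema are meaningful for all sets.     *)
Definition hausdorff_dist n (O1 O2 : set 'cV[R]_n) : \bar R :=
  maxe
    (ereal_sup [set ereal_inf [set (l2norm (u - z))%:E | z in O2] | u in O1])
    (ereal_sup [set ereal_inf [set (l2norm (u - z))%:E | u in O1] | z in O2]).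

(* Weak range space property of order k of a matrix B, used with B := A^T.    *)
Definition weak_RSP n m (k : nat) (B : 'M[R]_(n, m)) : Prop :=
  forall S1 S2 : {set 'I_n},
    [disjoint S1 & S2]%bool -> (#|S1| + #|S2| <= k)%N ->
    exists zeta : 'cV[R]_n,
      [/\ exists u : 'cV[R]_m, zeta = B *m u,
          forall i, i \in S1 -> zeta i 0 = 1,
          forall i, i \in S2 -> zeta i 0 = - 1
        & forall i, i \notin (S1 :|: S2)%SET -> `|zeta i 0| <= 1].

End Vectors.

Arguments stdvec {R n} i.

Section Polytopes.
Variables (R : realType) (q : nat).
Implicit Types (K P : set 'cV[R]_q) (phi : 'cV[R]_q -> R).

Definition conv_hull (s : seq 'cV[R]_q) : set 'cV[R]_q :=
  [set x | exists w : 'I_(size s) -> R,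
     [/\ forall i, 0 <= w i, \sum_i w i = 1 & x = \sum_i w i *: s`_i]].

Definition is_polytope P : Prop := exists s : seq 'cV[R]_q, P = conv_hull s.

Definition vertices P : set 'cV[R]_q :=
  [set x | P x /\ forall (u v : 'cV[R]_q) (t : R), P u -> P v -> 0 < t < 1 ->
     x = t *: u + (1 - t) *: v -> u = x /\ v = x].

Definition symmetric_set P : Prop := forall x, P x -> P (- x).

Definition scale_set (r : R) P : set 'cV[R]_q := [set r *: x | x in P].

(* K contains d + 1 affinely independent points.                              *)
Definition affdim_ge K (d : nat) : Prop :=
  exists (x0 : 'cV[R]_q) (x : 'I_d -> 'cV[R]_q),
    [/\ K x0, forall i, K (x i)
      & \rank (\matrix_(i < d) (x i - x0)^T) = d].

(* a is an outer normal of a facet of K, where K is a polytope with nonempty  *)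
(* interior: the face of K exposed by a has dimension q - 1 (it cannot be     *)
(* larger, as a <> 0).                                                        *)
Definition outer_facet_normal K (a : 'cV[R]_q) : Prop :=
  a <> 0 /\
  exists beta : R, (forall x, K x -> dotv a x <= beta) /\
    affdim_ge (K `&` [set x | dotv a x = beta]) q.-1.

(* P_eps for a given eps                                                      *)
Definition barvinok_polytope phi (chi eps : R) P : Prop :=
  [/\ is_polytope P, symmetric_set P,
      finite_set (vertices P) /\
      (#|` fset_set (vertices P)|)%fset%:R
        <= (chi / Num.sqrt eps * ln (1 / eps)) ^+ q,
      P `<=` unit_ball phi
    & unit_ball phi `<=` scale_set (1 + eps) P].

Definition barvinok_family phi (chi eps0 : R) (P : R -> set 'cV[R]_q) : Prop :=
  forall eps, 0 < eps < eps0 -> barvinok_polytope phi chi eps (P eps).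

(* The vectors a^i.  Since phi^*(a) is the maximum of a^T x over the unit     *)
(* ball, a^T x <= 1 is the half-space bounded by the parallel shift of the    *)
(* facet hyperplane which touches the ball when phi^*(a) = 1.                 *)
Definition facet_normals phi (P : R -> set 'cV[R]_q) (eps : R)
  : set 'cV[R]_q :=
  [set a | outer_facet_normal (scale_set (1 + eps) (P eps)) a
           /\ dual_norm phi a = 1].

Definition halfspaces (Y : set 'cV[R]_q) : set 'cV[R]_q :=
  [set z | forall a, Y a -> dotv a z <= 1].

Definition P_hat phi (P : R -> set 'cV[R]_q) (eps : R)
  : set 'cV[R]_q :=
  halfspaces (facet_normals phi P eps).

Definition box_normals : set 'cV[R]_q :=
  [set a | exists i, a = stdvec i \/ a = - stdvec i].

Definition P_bar phi (P : R -> set 'cV[R]_q) (eps : R)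
  : set 'cV[R]_q :=
  P_hat phi P eps `&` halfspaces box_normals.

(* Sequences are indexed from 0: eps 0, eps 1, ... stand for the epsilon_1,   *)
(* epsilon_2, ... of the mathematics, and index j for j + 1.                  *)
Definition Qpoly phi (P : R -> set 'cV[R]_q) (eps : nat -> R) (j : nat)
  : set 'cV[R]_q :=
  \bigcap_(k in [set k | (k <= j)%N]) P_bar phi P (eps k).

(* The set of vectors defining the half-spaces of Qpoly.                      *)
Definition Qnormals phi (P : R -> set 'cV[R]_q) (eps : nat -> R) (j : nat)
  : set 'cV[R]_q :=
  (\bigcup_(k in [set k | (k <= j)%N]) facet_normals phi P (eps k))
  `|` box_normals.

(* The columns of Gamma list the elements of Y without repetition, in an      *)
(* arbitrary order.                                                           *)
Definition columns_enumerate N (Gamma : 'M[R]_(q, N)) (Y : set 'cV[R]_q)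
  : Prop :=
  injective (fun j => col j Gamma) /\ range (fun j => col j Gamma) = Y.

End Polytopes.

Section Problem.
Variables (R : realType) (m n q : nat).
Variables (A : 'M[R]_(m, n)) (M : 'M[R]_(m, q)) (y : 'cV[R]_m) (tau : R).
Variable phi : 'cV[R]_q -> R.

Definition resid (x : 'cV[R]_n) : 'cV[R]_q := M^T *m (A *m x - y).

Definition feasible : set 'cV[R]_n := [set x | phi (resid x) <= tau].

Definition opt_solution : set 'cV[R]_n :=
  [set x | feasible x /\ forall z, feasible z -> l1norm x <= l1norm z].

Definition opt_value : R := inf [set l1norm x | x in feasible].

Definition sol_set : set 'cV[R]_n :=
  [set x | l1norm x <= opt_value /\ phi (resid x) <= tau].

Definition relaxed_set (Q : set 'cV[R]_q) : set 'cV[R]_n :=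
  [set x | l1norm x <= opt_value /\ Q (tau^-1 *: resid x)].

(* M_G; when #|G| = m, conform_mx only transports the columns of M indexed by *)
(* G from 'M_(m, #|G|) to 'M_m.                                               *)
Definition colsubG (G : {set 'I_q}) : 'M[R]_m :=
  conform_mx 0 (colsub (fun j : 'I_#|G| => enum_val j) M).

(* The default value 0 of the maximum plays no role: all the norms are        *)
(* nonnegative, and there is an admissible G when M has rank m.               *)
Definition cst_c : R :=
  \big[Num.max/0]_(G : {set 'I_q} | (#|G| == m) && (colsubG G \in unitmx))
     norm_inf_to_1 (invmx (colsubG G) *m invmx (A *m A^T) *m A).

End Problem.

Section Robinson.
Variable R : realType.

(* Na and Nb are the norms with index alpha_1 and alpha_2, in all dimensions. *)
Variables Na Nb : forall p, 'cV[R]_p -> R.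

Definition lin_sys p1 p2 r (M1 : 'M[R]_(p1, r)) (M2 : 'M[R]_(p2, r))
    (d1 : 'cV[R]_p1) (d2 : 'cV[R]_p2) : set 'cV[R]_r :=
  [set u | le_vec (M1 *m u) d1 /\ M2 *m u = d2].

Definition robinson_mu p1 p2 r (M1 : 'M[R]_(p1, r)) (M2 : 'M[R]_(p2, r)) : R :=
  sup [set inf [set Na u | u in lin_sys M1 M2 d.1 d.2]
      | d in [set d : 'cV[R]_p1 * 'cV[R]_p2 |
                lin_sys M1 M2 d.1 d.2 !=set0 /\ Nb (col_mx d.1 d.2) <= 1]].

(* The default value 0 of the maximum plays no role, as every robinson_mu is  *)
(* nonnegative when Na is.                                                    *)
Definition robinson_sigma m1 m2 l (N1 : 'M[R]_(m1, l)) (N2 : 'M[R]_(m2, l))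
  : R :=
  \big[Num.max/0]_(S : {set 'I_m1})
     robinson_mu
       (block_mx (rowsub (fun i : 'I_#|S| => enum_val i) 1%:M) 0
                 (- 1%:M) 0 : 'M[R]_(#|S| + m1, m1 + m2))
       (col_mx N1 N2)^T.

End Robinson.

Section BlockMatrices.
Variables (R : realType) (m n q N : nat).
Variables (A : 'M[R]_(m, n)) (M : 'M[R]_(m, q)) (y : 'cV[R]_m) (tau : R).
Variable Gamma : 'M[R]_(q, N).

Definition row5 p (B1 B2 B3 B4 : 'M[R]_(p, n)) (B5 : 'M[R]_(p, N))
  : 'M[R]_(p, n + (n + (n + (n + N)))) :=
  row_mx B1 (row_mx B2 (row_mx B3 (row_mx B4 B5))).

Definition Mbar1
  : 'M[R]_(n + (n + (n + (N + (n + (n + (n + N)))))),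
           n + (n + (n + (n + N)))) :=
  let I : 'M[R]_n := 1%:M in
  let Ihat : 'M[R]_N := 1%:M in
  col_mx (row5 I     (- I) 0     0     0)
 (col_mx (row5 (- I) (- I) 0     0     0)
 (col_mx (row5 0     0     I     I     0)
 (col_mx (row5 ((M *m Gamma)^T *m A) 0 0 0 0)
 (col_mx (row5 0     (- I) 0     0     0)
 (col_mx (row5 0     0     (- I) 0     0)
 (col_mx (row5 0     0     0     (- I) 0)
         (row5 0     0     0     0     (- Ihat)))))))).

Definition Mbar2 : 'M[R]_(n + 1, n + (n + (n + (n + N)))) :=
  let I : 'M[R]_n := 1%:M in
  col_mx (row5 0 0            I (- I) (A^T *m M *m Gamma))
         (row5 0 (const_mx 1) 0 0     (tau *: const_mx 1 + y^T *m M *m Gamma)).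

Definition gamma_bar : R :=
  robinson_sigma (@linfnorm R) (@l2norm R) Mbar1 Mbar2.

End BlockMatrices.

(* Main.v *)
(* Relaxing the norm ball to the polytope Q turns (P) into a linear program   *)
(* whose optimal primal-dual pairs form a polyhedron, the solution set of     *)
(* [Mbar1 z <= rhs], [Mbar2 z = 0].  By Robinson's error bound, a point z is  *)
(* within gamma_bar times its residual of this polyhedron.  Given x, complete *)
(* it by t = |x| and by the dual point read off a range vector of A^T that    *)
(* agrees in sign with x on a best k-term support: the residual of the        *)
(* resulting z is controlled by the constraint violation, by sigma_k(x)_1 and *)
(* by c.  By weak duality the x-part of a primal-dual pair lies in the        *)
(* relaxed set, hence within delta of an optimal solution of (P).             *)

Require Import Defs.
From HB Require Import structures.
From mathcomp Require Import all_boot all_order all_algebra.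
From mathcomp Require Import all_classical all_reals all_analysis.
From mathcomp Require Import ring lra.
Import numFieldNormedType.Exports.
Import Order.TTheory GRing.Theory Num.Theory.

Set Implicit Arguments.
Unset Strict Implicit.
Unset Printing Implicit Defensive.

Local Open Scope classical_set_scope.
Local Open Scope ring_scope.

(** The relaxed problem minimizes ||x||_1 subject to G x <= b, where G = (M Gamma)^T A and b = tau 1
    + (M Gamma)^T y. With a bound t >= |x| it becomes a linear program, and optimality of a point
    (x, t, w1, w2, v) is expressed by primal feasibility, dual feasibility and zero duality gap;
    this is [opt_sys], solvable by [l1_lp_duality].

    A given x is completed by t = |x|, by the positive and negative parts w1, w2 of zeta = A^T u
    from [weak_RSP_certificate], and by some v >= 0 with M Gamma v = - u and total mass at most c
    ([Gamma_multiplier]). The dual constraints then hold exactly and only two residuals survive.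
    Since a^T z <= phi z for every column a of Gamma, each row of G x <= b is violated by at most
    (phi - tau)^+. The gap is (||x||_1 - x^T zeta) + tau 1^T v + u^T (A x - y), whose terms are
    bounded in absolute value by 2 sigma_k, c tau and c phi.

    [robinson_error_bound] turns this residual into a distance to some solution of [opt_sys]. Its
    x-part z is relaxed feasible and no longer in l1 norm than any feasible point
    ([opt_sys_weak_duality]), so [hausdorff_nearest] yields an optimal solution within delta of
    z. *)

(** * Inner product and the l1, l2 and max norms *)

Section EuclideanVectors.
Variable R : realType.
Implicit Types n : nat.

Lemma cV_addE n (u v : 'cV[R]_n) i : (u + v) i 0 = u i 0 + v i 0.
Proof. exact: mxE. Qed.

Lemma cV_scaleE n a (u : 'cV[R]_n) i : (a *: u) i 0 = a * u i 0.
Proof. exact: mxE. Qed.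

Lemma cV_subE n (u v : 'cV[R]_n) i : (u - v) i 0 = u i 0 - v i 0.
Proof. by rewrite !mxE. Qed.

Lemma dotvE n (u v : 'cV[R]_n) : dotv u v = \sum_i u i 0 * v i 0.
Proof. by rewrite /dotv mxE; apply: eq_bigr => i _; rewrite mxE. Qed.

Lemma dotvC n (u v : 'cV[R]_n) : dotv u v = dotv v u.
Proof. by rewrite !dotvE; apply: eq_bigr => i _; rewrite mulrC. Qed.

Lemma dotvDr n (u v w : 'cV[R]_n) : dotv u (v + w) = dotv u v + dotv u w.
Proof. by rewrite /dotv mulmxDr mxE. Qed.

Lemma dotvZr n (u v : 'cV[R]_n) a : dotv u (a *: v) = a * dotv u v.
Proof. by rewrite /dotv -scalemxAr mxE. Qed.

Lemma dotvNr n (u v : 'cV[R]_n) : dotv u (- v) = - dotv u v.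
Proof. by rewrite /dotv mulmxN mxE. Qed.

Lemma dotvBr n (u v w : 'cV[R]_n) : dotv u (v - w) = dotv u v - dotv u w.
Proof. by rewrite dotvDr dotvNr. Qed.

Lemma dotv0r n (u : 'cV[R]_n) : dotv u 0 = 0.
Proof. by rewrite /dotv mulmx0 mxE. Qed.

Lemma dotvDl n (u v w : 'cV[R]_n) : dotv (u + v) w = dotv u w + dotv v w.
Proof. by rewrite dotvC dotvDr !(dotvC w). Qed.

Lemma dotvZl n (u v : 'cV[R]_n) a : dotv (a *: u) v = a * dotv u v.
Proof. by rewrite dotvC dotvZr (dotvC v). Qed.

Lemma dotvNl n (u v : 'cV[R]_n) : dotv (- u) v = - dotv u v.
Proof. by rewrite dotvC dotvNr (dotvC v). Qed.

Lemma dotvBl n (u v w : 'cV[R]_n) : dotv (u - v) w = dotv u w - dotv v w.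
Proof. by rewrite dotvDl dotvNl. Qed.

Lemma dotv0l n (u : 'cV[R]_n) : dotv 0 u = 0.
Proof. by rewrite dotvC dotv0r. Qed.

Lemma dotv_suml n (I : Type) (s : seq I) (F : I -> 'cV[R]_n) v :
  dotv (\sum_(i <- s) F i) v = \sum_(i <- s) dotv (F i) v.
Proof.
by elim/big_rec2: _ => [|i y1 y2 _ <-]; rewrite ?dotv0l ?dotvDl.
Qed.

Lemma dotv_mull p n (B : 'M[R]_(p, n)) u v : dotv (B *m u) v = dotv u (B^T *m v).
Proof. by rewrite /dotv trmx_mul mulmxA. Qed.

Lemma dotv_mulr p n (B : 'M[R]_(p, n)) u v : dotv u (B *m v) = dotv (B^T *m u) v.
Proof. by rewrite dotv_mull trmxK. Qed.

Lemma dotv_col_mx p n (u1 v1 : 'cV[R]_p) (u2 v2 : 'cV[R]_n) :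
  dotv (col_mx u1 u2) (col_mx v1 v2) = dotv u1 v1 + dotv u2 v2.
Proof. by rewrite /dotv tr_col_mx mul_row_col mxE. Qed.

Lemma dotv_stdvec n (i : 'I_n) (x : 'cV[R]_n) : dotv (stdvec i) x = x i 0.
Proof.
rewrite dotvE (bigD1 i)//= big1 ?addr0 => [|j /negbTE ji].
  by rewrite mxE !eqxx mul1r.
by rewrite mxE ji mul0r.
Qed.

Lemma dotvv n (u : 'cV[R]_n) : dotv u u = l2norm u ^+ 2.
Proof.
rewrite /l2norm sqr_sqrtr ?dotvE ?sumr_ge0// => i _; exact: sqr_ge0.
Qed.

Lemma dotvv_ge0 n (u : 'cV[R]_n) : 0 <= dotv u u.
Proof. by rewrite dotvv sqr_ge0. Qed.

Lemma dotvv_eq0 n (u : 'cV[R]_n) : dotv u u = 0 -> u = 0.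
Proof.
rewrite dotvE => /eqP; rewrite psumr_eq0 => [/allP h|i _]; last first.
  by rewrite -expr2 sqr_ge0.
apply/matrixP => i j; rewrite ord1 mxE; apply/eqP.
by have := h i (mem_index_enum _); rewrite mulf_eq0 orbb.
Qed.

Lemma le_norm_matrix p n (x : 'M[R]_(p, n)) a :
  0 <= a -> (forall i j, `|x i j| <= a) -> `|x| <= a.
Proof.
move=> a0 xa; rewrite -[`|x|]/(mx_norm x) mx_normrE.
by apply: bigmax_le => // -[i j] _; exact: xa.
Qed.

Lemma coord_le_linf n (x : 'cV[R]_n) i : `|x i 0| <= `|x|.
Proof.
rewrite -[leRHS]/(mx_norm x) mx_normrE.
exact: (le_bigmax_cond _ (fun ij : 'I_n * 'I_1 => `|x ij.1 ij.2|) (j := (i, 0))).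
Qed.

Lemma dotv_le_linf_l1 n (u v : 'cV[R]_n) : dotv u v <= linfnorm u * l1norm v.
Proof.
rewrite dotvE /l1norm mulr_sumr; apply: ler_sum => i _.
rewrite (le_trans (ler_norm _))// normrM ler_wpM2r//; exact: coord_le_linf.
Qed.

Lemma l2norm_ge0 n (u : 'cV[R]_n) : 0 <= l2norm u.
Proof. exact: sqrtr_ge0. Qed.

Lemma l2norm_eq0 n (u : 'cV[R]_n) : l2norm u = 0 -> u = 0.
Proof. by move=> u0; apply: dotvv_eq0; rewrite dotvv u0 expr0n. Qed.

Lemma cauchy_schwarz n (u v : 'cV[R]_n) : dotv u v <= l2norm u * l2norm v.
Proof.
have [u0|/eqP] := eqVneq (l2norm u) 0.
  by rewrite (l2norm_eq0 u0) dotv0l mulr_ge0// l2norm_ge0.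
move=> /eqP un0.
have up : 0 < l2norm u by rewrite lt_neqAle eq_sym un0 l2norm_ge0.
have [v0|vn0] := eqVneq (l2norm v) 0.
  by rewrite (l2norm_eq0 v0) dotv0r mulr_ge0// l2norm_ge0.
have vp : 0 < l2norm v by rewrite lt_neqAle eq_sym vn0 l2norm_ge0.
(* With a, b the norms and d the inner product, this square is 2ab(ab - d). *)
have := dotvv_ge0 (l2norm v *: u - l2norm u *: v).
rewrite dotvBl !dotvBr !dotvZl !dotvZr !dotvv (dotvC v u).
set a := l2norm u; set b := l2norm v; set d := dotv u v.
rewrite (_ : _ - _ = 2 * (a * b) * (a * b - d)); last first.
  by rewrite mulrBr !expr2 mulr_natl; ring.
by rewrite pmulr_rge0 ?subr_ge0// mulr_gt0// mulr_gt0.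
Qed.

Lemma l2norm_triangle n (u v : 'cV[R]_n) : l2norm (u + v) <= l2norm u + l2norm v.
Proof.
rewrite -(@ler_pXn2r _ 2) ?nnegrE ?addr_ge0 ?l2norm_ge0//.
rewrite -dotvv dotvDl !dotvDr !dotvv (dotvC v u) sqrrD.
have := cauchy_schwarz u v; set d := dotv u v; set a := l2norm u; set b := l2norm v.
by rewrite mulr2n => h; lra.
Qed.

Lemma l2normZ n a (u : 'cV[R]_n) : l2norm (a *: u) = `|a| * l2norm u.
Proof.
rewrite /l2norm -sqrtr_sqr -sqrtrM ?sqr_ge0//; congr Num.sqrt.
by rewrite mulr_sumr; apply: eq_bigr => i _; rewrite mxE exprMn.
Qed.

Lemma l1normZ n a (u : 'cV[R]_n) : l1norm (a *: u) = `|a| * l1norm u.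
Proof. by rewrite /l1norm mulr_sumr; apply: eq_bigr => i _; rewrite mxE normrM. Qed.

Lemma l1norm_triangle n (u v : 'cV[R]_n) : l1norm (u + v) <= l1norm u + l1norm v.
Proof. by rewrite /l1norm -big_split; apply: ler_sum => i _; rewrite mxE ler_normD. Qed.

Lemma l1norm_ge0 n (u : 'cV[R]_n) : 0 <= l1norm u.
Proof. by apply: sumr_ge0. Qed.

Lemma linf_le_l1 n (u : 'cV[R]_n) : `|u| <= l1norm u.
Proof.
apply: le_norm_matrix; first exact: l1norm_ge0.
move=> i j; rewrite ord1 /l1norm (bigD1 i)//= lerDl; exact: sumr_ge0.
Qed.

Lemma coord_le_l2 n (u : 'cV[R]_n) i : `|u i 0| <= l2norm u.
Proof.
rewrite -sqrtr_sqr ler_wsqrtr// (bigD1 i)//= lerDl sumr_ge0// => j _; exact: sqr_ge0.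
Qed.

Lemma linf_le_l2 n (u : 'cV[R]_n) : `|u| <= l2norm u.
Proof.
apply: le_norm_matrix; first exact: l2norm_ge0.
by move=> i j; rewrite ord1 coord_le_l2.
Qed.

Lemma l2norm_col_mx p n (u : 'cV[R]_p) (v : 'cV[R]_n) : l2norm u <= l2norm (col_mx u v).
Proof.
rewrite ler_wsqrtr// big_split_ord/=.
under [X in _ <= X + _]eq_bigr do rewrite col_mxEu.
by rewrite lerDl sumr_ge0// => j _; exact: sqr_ge0.
Qed.

End EuclideanVectors.

(** * Minimizers of coercive Lipschitz functions *)

Section Minimization.
Variable R : realType.

(** Lipschitz continuity for the max norm: exchanging [x] and [y] gives the two-sided bound, and the
    sign of [C] is left free. *)
Definition lip n (f : 'cV[R]_n -> R) :=
  exists C : R, forall x y, f x <= f y + C * `|x - y|.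

(** These are the seminorms; [phi], [l1norm] and [l2norm] are treated together through this
    notion. *)
Definition sublinear n (f : 'cV[R]_n -> R) :=
  (forall x y, f (x + y) <= f x + f y) /\ (forall a x, f (a *: x) = `|a| * f x).

Lemma sublinear0 n (f : 'cV[R]_n -> R) : sublinear f -> f 0 = 0.
Proof. by move=> [_ fZ]; rewrite -(scale0r 0) fZ normr0 mul0r. Qed.

Lemma sublinearN n (f : 'cV[R]_n -> R) x : sublinear f -> f (- x) = f x.
Proof. by move=> [_ fZ]; rewrite -scaleN1r fZ normrN1 mul1r. Qed.

Lemma sublinear_ge0 n (f : 'cV[R]_n -> R) x : sublinear f -> 0 <= f x.
Proof.
move=> fs; have := fs.1 x (- x); rewrite subrr sublinear0// sublinearN//.
by move=> h; lra.
Qed.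

Lemma sublinear_bound n (f : 'cV[R]_n -> R) :
  sublinear f -> exists C : R, forall w, f w <= C * `|w|.
Proof.
move=> fs; exists (\sum_i f (stdvec i)) => w.
have -> : f w = f (\sum_i w i 0 *: stdvec i).
  congr f; apply/matrixP => i j; rewrite ord1 summxE (bigD1 i)//= big1 => [|l /negbTE li].
    by rewrite !mxE !eqxx mulr1 addr0.
  by rewrite !mxE eq_sym li mulr0.
apply: (@le_trans _ _ (\sum_i `|w i 0| * f (stdvec i))).
  elim/big_rec2: _ => [|i a b _ ab]; first by rewrite sublinear0.
  by rewrite (le_trans (fs.1 _ _))// fs.2 lerD2l.
rewrite mulr_suml; apply: ler_sum => i _.
by rewrite mulrC ler_wpM2l ?coord_le_linf// sublinear_ge0.
Qed.

Lemma sublinear_comp n p (f : 'cV[R]_n -> R) (B : 'M[R]_(n, p)) :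
  sublinear f -> sublinear (fun x => f (B *m x)).
Proof. by move=> [fD fZ]; split=> [x y|a x]; rewrite ?mulmxDr// -scalemxAr. Qed.

Lemma lip_affine n p (f : 'cV[R]_n -> R) (B : 'M[R]_(n, p)) (b : 'cV[R]_n) a :
  sublinear f -> lip (fun x => f (B *m x - b) + a).
Proof.
move=> fs; have [C fC] := sublinear_bound (sublinear_comp B fs).
exists C => x y; have -> : B *m x - b = (B *m y - b) + B *m (x - y).
  by rewrite mulmxBr [RHS]addrC addrA subrK.
rewrite [leRHS]addrAC lerD2r (le_trans (fs.1 _ _))// lerD2l; exact: fC.
Qed.

Lemma lip_shift n (f : 'cV[R]_n -> R) z : sublinear f -> lip (fun x => f (x - z)).
Proof.
move=> fS; have [C fC] := lip_affine 1%:M z 0 fS.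
by exists C => u v; have := fC u v; rewrite !mul1mx !addr0.
Qed.

Lemma sublinear_l1norm n : sublinear (@l1norm R n).
Proof. by split=> [x z|a x]; [exact: l1norm_triangle|exact: l1normZ]. Qed.

Lemma sublinear_l2norm n : sublinear (@l2norm R n).
Proof. by split=> [x z|a x]; [exact: l2norm_triangle|exact: l2normZ]. Qed.

Lemma lip_dotv n (u : 'cV[R]_n) a : lip (fun x => dotv u x + a).
Proof.
exists (l1norm u) => x y.
rewrite [leRHS]addrAC lerD2r -lerBlDl -dotvBr dotvC mulrC; exact: dotv_le_linf_l1.
Qed.

(** Coercivity makes the feasible part of the sublevel set of [f] at a feasible point compact, so
    [f] attains its minimum there. The transposes pass to row vectors, the form in which
    [bounded_closed_compact] applies. *)
Lemma lip_minimizer n (I : Type) (h : I -> 'cV[R]_n -> R) (f : 'cV[R]_n -> R) (b : R) :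
  (forall i, lip (h i)) -> lip f -> (forall x, `|x| <= f x + b) ->
  (exists x, forall i, h i x <= 0) ->
  exists2 x, (forall i, h i x <= 0) & forall z, (forall i, h i z <= 0) -> f x <= f z.
Proof.
have trn p r (w : 'M[R]_(p, r)) : `|w^T| <= `|w|.
  apply: le_norm_matrix => // i j; rewrite mxE.
  rewrite -[leRHS]/(mx_norm _) mx_normrE.
  exact: (le_bigmax_cond _ (fun ij : 'I_p * 'I_r => `|w ij.1 ij.2|) (j := (j, i))).
have lipc (g : 'cV[R]_n -> R) : lip g -> continuous (fun v : 'rV[R]_n => g v^T).
  move=> [C gC] v; have := nbhs_filter v => nbhs_v.
  apply/cvgrPdist_lt => e e0.
  have C1 : 0 < `|C| + 1 by rewrite ltr_wpDl.
  have vball : \forall w \near v, `|v - w| < e / (`|C| + 1).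
    apply/nbhs_ballP; exists (e / (`|C| + 1)); first exact: divr_gt0.
    by move=> w; rewrite -ball_normE.
  apply: filterS vball => w vw.
  have bnd x y : `|x - y| <= `|v - w| -> g x - g y < e.
    move=> xy; rewrite (@le_lt_trans _ _ ((`|C| + 1) * `|v - w|))//; last first.
      by rewrite mulrC -ltr_pdivlMr.
    rewrite lerBlDl (le_trans (gC x y))// lerD2l.
    rewrite (@le_trans _ _ (`|C| * `|x - y|)) ?ler_wpM2r ?ler_norm//.
    by rewrite ler_pM// lerDl.
  rewrite ltr_norml ltrNl opprB; apply/andP; split; apply: bnd.
    by rewrite -linearB (le_trans (trn _ _ _))// distrC.
  by rewrite -linearB trn.
move=> hl fl fb [x0 hx0].
pose K := [set v : 'rV[R]_n | (forall i, h i v^T <= 0) /\ f v^T <= f x0].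
have K0 : K !=set0 by exists x0^T; rewrite /K/= trmxK.
have cK : compact K.
  apply: bounded_closed_compact.
    exists (f x0 + b); split; first exact: num_real.
    move=> r xr v [_ fv]; have := trn _ _ v^T; rewrite trmxK => /le_trans; apply.
    by rewrite (le_trans (fb _))// (le_trans _ (ltW xr))// lerD2r.
  have -> : K = \bigcap_(i in [set: option I])
     ((fun v : 'rV[R]_n => if i is Some j then h j v^T else f v^T)
        @^-1` [set y | y <= if i is Some _ then 0 else f x0]).
    apply/seteqP; split=> v /=.
      by move=> [hv fv] [i|] _ /=; rewrite ?fv ?hv.
    move=> vK; split=> [i|]; first exact: (vK (Some i) Logic.I).
    exact: (vK None Logic.I).
  apply: closed_bigI => -[i|] _; apply: closed_comp; try exact: closed_le.
    by move=> v _; exact: (lipc _ (hl i) v).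
  by move=> v _; exact: (lipc _ fl v).
have [|v vK vmin] := compact_EVT_min K0 cK (f := fun v => f v^T).
  exact: (continuous_subspaceT (lipc _ fl)).
rewrite inE in vK; exists v^T; first by move=> i; exact: vK.1.
move=> z hz; have [fz|/ltW fz] := leP (f z) (f x0); last exact: le_trans vK.2 fz.
by have := vmin z^T; rewrite trmxK inE; apply; rewrite /K/= trmxK.
Qed.

(** Puts a polyhedron in the form required by [lip_minimizer], each equation being split into two
    inequalities. *)
Lemma lin_sys_setP p1 p2 r (M1 : 'M[R]_(p1, r)) (M2 : 'M[R]_(p2, r)) d1 d2 :
  exists (I : Type) (h : I -> 'cV[R]_r -> R), (forall i, lip (h i)) /\
  forall u, lin_sys M1 M2 d1 d2 u <-> forall i, h i u <= 0.
Proof.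
exists ('I_p1 + ('I_p2 + 'I_p2))%type.
exists (fun i u => match i with
  | inl j => dotv (row j M1)^T u + (- d1 j 0)
  | inr (inl j) => dotv (row j M2)^T u + (- d2 j 0)
  | inr (inr j) => dotv (- (row j M2)^T) u + d2 j 0 end); split.
  by move=> [j|[j|j]]; exact: lip_dotv.
have rowE p (B : 'M[R]_(p, r)) j u : dotv (row j B)^T u = (B *m u) j 0.
  by rewrite /dotv trmxK -row_mul mxE.
move=> u; split=> [[u1 u2] [j|[j|j]]|uh].
- by rewrite rowE subr_le0 u1.
- by rewrite rowE u2 subrr.
- by rewrite dotvNl rowE u2 addNr.
split=> [j|]; first by have := uh (inl j); rewrite rowE subr_le0.
apply/matrixP => j l; rewrite ord1; apply/eqP; rewrite eq_le.
have := uh (inr (inl j)); have := uh (inr (inr j)).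
by rewrite dotvNl rowE addrC !subr_le0 => -> ->.
Qed.

End Minimization.

(** * Farkas' lemma and polyhedra *)

Section Polyhedra.
Variable R : realType.

(* Bartl's elimination argument: if [x0] witnesses that [a i] cannot be       *)
(* dropped, projecting all functionals along [x0] removes [a i].              *)
Lemma farkas n (I : eqType) (s : seq I) (a : I -> 'cV[R]_n) (b : 'cV[R]_n) :
  uniq s ->
  (forall x, (forall i, i \in s -> dotv (a i) x <= 0) -> dotv b x <= 0) ->
  exists2 w : I -> R, forall i, 0 <= w i & b = \sum_(i <- s) w i *: a i.
Proof.
elim: s a b => [a b _ ab|i s IHs a b /andP[si us] ab].
  exists (fun=> 0) => //; rewrite big_nil; apply: dotvv_eq0.
  by apply/eqP; rewrite eq_le dotvv_ge0 ab.
have eq_upd (w : I -> R) t (v : I -> 'cV[R]_n) :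
    \sum_(j <- s) (if j == i then t else w j) *: v j = \sum_(j <- s) w j *: v j.
  rewrite !big_seq; apply: eq_bigr => j js.
  by case: eqP => // ji; rewrite -ji js in si.
have [sb|] :=
    pselect (forall x, (forall j, j \in s -> dotv (a j) x <= 0) -> dotv b x <= 0).
  have [w w0 ->] := IHs a b us sb.
  exists (fun j => if j == i then 0 else w j) => [j|]; first by case: ifP.
  by rewrite big_cons eqxx scale0r add0r eq_upd.
move=> /existsNP[x0] /not_implyP[ax0] /negP; rewrite -ltNge => bx0.
have aix0 : 0 < dotv (a i) x0.
  rewrite ltNge; apply/negP => aix0; move: bx0; rewrite ltNge ab// => j.
  by rewrite inE => /orP[/eqP ->//|]; exact: ax0.
pose al := dotv (a i) x0.
(* [pr c] vanishes at [x0]. By [prE], evaluating it at [x] amounts to evaluating [c] at the point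
   where the line through [x] along [x0] meets the hyperplane orthogonal to [a i]. *)
pose pr (c : 'cV[R]_n) := c - (dotv c x0 / al) *: a i.
have prE c x : dotv (pr c) x = dotv c (x - (dotv (a i) x / al) *: x0).
  by rewrite dotvBl dotvZl dotvBr dotvZr; ring.
have [|w w0 prb] := IHs (pr \o a) (pr b) us.
  move=> x ax; rewrite prE; apply: ab => j; rewrite inE => /orP[/eqP ->|js].
    by rewrite dotvBr dotvZr divfK ?subrr// gt_eqF.
  by rewrite -prE; exact: ax.
(* The weight of [a i] collects what the projections removed; it is nonnegative as [b] is positive
   at [x0] while every remaining [a j] is nonpositive there. *)
exists (fun j => if j == i then (dotv b x0 - \sum_(j <- s) w j * dotv (a j) x0) / al
                 else w j).
  move=> j; case: ifP => // _; rewrite divr_ge0// ?ltW// subr_gt0.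
  apply: le_lt_trans bx0; rewrite big_seq; apply: sumr_le0 => l ls.
  by rewrite mulr_ge0_le0// ax0.
rewrite big_cons eqxx eq_upd -[LHS](subrK ((dotv b x0 / al) *: a i)).
rewrite -[b - _]/(pr b) prb /= addrC.
under eq_bigr do rewrite /pr scalerBr scalerA.
rewrite sumrB addrA addrAC -scaler_suml; congr (_ + _).
rewrite -scalerBl; congr (_ *: _); rewrite mulrBl mulr_suml; congr (_ - _).
by apply: eq_bigr => j _; rewrite mulrA.
Qed.

Lemma small_step (I : finType) (s c : I -> R) : (forall i, 0 < s i) ->
  exists2 e : R, 0 < e & forall i, e * c i <= s i.
Proof.
move=> s0; pose t := \sum_i `|c i| / s i.
have t0 : 0 <= t by apply: sumr_ge0 => i _; rewrite divr_ge0// ltW.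
exists (1 + t)^-1; first by rewrite invr_gt0 ltr_pwDl.
move=> i; rewrite mulrC ler_pdivrMr ?ltr_pwDl// (le_trans (ler_norm _))//.
rewrite mulrC -ler_pdivrMr// /t (bigD1 i)//= addrCA lerDl addr_ge0// sumr_ge0// => j _.
by rewrite divr_ge0// ltW.
Qed.

Lemma mulmx_trE p r (B : 'M[R]_(p, r)) (u : 'cV[R]_p) :
  B^T *m u = \sum_i u i 0 *: (row i B)^T.
Proof.
apply/matrixP => i j; rewrite ord1 summxE mxE; apply: eq_bigr => l _.
by rewrite !mxE mulrC.
Qed.

Lemma dotv_row p r (B : 'M[R]_(p, r)) i u : dotv (row i B)^T u = (B *m u) i 0.
Proof. by rewrite /dotv trmxK -row_mul mxE. Qed.

(** A short step from [z] stays feasible along any direction respecting the active inequalities and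
    the equations, so [g] is nonpositive on such directions. Farkas' lemma writes [g] with the
    active rows and both signs of the equation rows. *)
Lemma lin_sys_normal_cone p1 p2 r (N1 : 'M[R]_(p1, r)) (N2 : 'M[R]_(p2, r)) b1 b2 z g :
  lin_sys N1 N2 b1 b2 z ->
  (forall x, lin_sys N1 N2 b1 b2 x -> dotv g x <= dotv g z) ->
  exists (u1 : 'cV[R]_p1) (u2 : 'cV[R]_p2), [/\ forall i, 0 <= u1 i 0,
    forall i, (N1 *m z) i 0 < b1 i 0 -> u1 i 0 = 0 &
    g = N1^T *m u1 + N2^T *m u2].
Proof.
move=> [z1 z2] gz.
pose act (i : 'I_p1 + ('I_p2 + 'I_p2)) :=
  if i is inl j then (N1 *m z) j 0 == b1 j 0 else true.
pose a (i : 'I_p1 + ('I_p2 + 'I_p2)) := match i with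
  | inl j => (row j N1)^T | inr (inl j) => (row j N2)^T
  | inr (inr j) => - (row j N2)^T end.
have us : uniq [seq i <- index_enum _ | act i] by rewrite filter_uniq// index_enum_uniq.
have [x ax|w w0 ->] := @farkas r _ _ a g us.
  (* Inactive rows limit the step by their slack; the value 1 at active rows is only a positive
     placeholder for [small_step]. *)
  have slack0 i : 0 < if (N1 *m z) i 0 == b1 i 0 then 1 else b1 i 0 - (N1 *m z) i 0.
    by case: ifPn => // ne; rewrite subr_gt0 lt_neqAle ne z1.
  have [e e0 ex] := small_step (fun i => (N1 *m x) i 0) slack0.
  have {}ax i : act i -> dotv (a i) x <= 0.
    by move=> ai; apply: ax; rewrite mem_filter ai mem_index_enum.
  have : dotv g (z + e *: x) <= dotv g z.
    apply: gz; split=> [i|].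
      rewrite mulmxDr -scalemxAr cV_addE cV_scaleE.
      have := ex i; case: ifPn => [/eqP zi _|_]; last by rewrite lerBrDl.
      rewrite zi gerDl pmulr_rle0//.
      by have := ax (inl i); rewrite /= zi eqxx dotv_row; apply.
    rewrite mulmxDr -scalemxAr z2 (_ : N2 *m x = 0) ?scaler0 ?addr0//.
    apply/matrixP => i j; rewrite ord1 [RHS]mxE; apply/eqP; rewrite eq_le.
    have := ax (inr (inl i)) isT; have := ax (inr (inr i)) isT.
    by rewrite /a dotvNl dotv_row oppr_le0 => -> ->.
  by rewrite dotvDr dotvZr gerDl pmulr_rle0.
exists (\col_i if act (inl i) then w (inl i) else 0).
exists (\col_i (w (inr (inl i)) - w (inr (inr i)))); split.
- by move=> i; rewrite mxE; case: ifP.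
- by move=> i zi; rewrite mxE /act lt_eqF.
rewrite big_filter big_sumType/= big_sumType/= !mulmx_trE; congr (_ + _).
  by rewrite big_mkcond; apply: eq_bigr => i _; rewrite mxE; case: ifP; rewrite ?scale0r.
rewrite -big_split; apply: eq_bigr => i _.
by rewrite mxE /= scalerN scalerBl.
Qed.

Lemma linf_mulmx p r (Q : 'M[R]_(p, r)) (x : 'cV[R]_r) :
  `|Q *m x| <= (\sum_i \sum_j `|Q i j|) * `|x|.
Proof.
have s0 i : 0 <= \sum_j `|Q i j| by apply: sumr_ge0.
apply: le_norm_matrix; first by rewrite mulr_ge0// sumr_ge0.
move=> i j; rewrite ord1 mxE (le_trans (ler_norm_sum _ _ _))//.
apply: (@le_trans _ _ ((\sum_j `|Q i j|) * `|x|)).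
  by rewrite mulr_suml; apply: ler_sum => l _; rewrite normrM ler_wpM2l// coord_le_linf.
by rewrite ler_wpM2r// (bigD1 i)//= lerDl sumr_ge0.
Qed.

(* A feasible point with as many active inequalities as possible lies on a    *)
(* minimal face, which is the full solution set of its active equations.      *)
Lemma lin_sys_minimal_face p1 p2 r (M1 : 'M[R]_(p1, r)) (M2 : 'M[R]_(p2, r)) d1 d2 :
  lin_sys M1 M2 d1 d2 !=set0 ->
  exists (T : {set 'I_p1}) (u : 'cV[R]_r),
   [/\ forall i, i \in T -> (M1 *m u) i 0 = d1 i 0, M2 *m u = d2 &
    forall v, (forall i, i \in T -> (M1 *m v) i 0 = d1 i 0) -> M2 *m v = d2 ->
     lin_sys M1 M2 d1 d2 v].
Proof.
move=> [u0 u0P].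
pose act (u : 'cV[R]_r) : {set 'I_p1} := [set i | (M1 *m u) i 0 == d1 i 0]%SET.
pose P k := `[< exists2 u, lin_sys M1 M2 d1 d2 u & #|act u| = k >].
have exP : exists k, P k by exists #|act u0|; apply/asboolP; exists u0.
have Ple k : P k -> (k <= p1)%N.
  by move=> /asboolP[u _ <-]; rewrite -[leqRHS]card_ord max_card.
have [k /asboolP[u uP uk] kmax] := ex_maxnP exP Ple.
exists (act u), u; split; [by move=> i; rewrite inE => /eqP|by have [] := uP|].
have noray (w : 'cV[R]_r) : (forall i, i \in act u -> (M1 *m w) i 0 = 0) -> M2 *m w = 0 ->
    forall i, (M1 *m w) i 0 <= 0.
  move=> w1 w2 i; rewrite leNgt; apply/negP => wi.
  (* Ratio test: moving along [w] up to the first blocking row [l] keeps all active rows and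
     activates [l], against maximality. *)
  pose ratio j := (d1 j 0 - (M1 *m u) j 0) / (M1 *m w) j 0.
  have [l wl lmin] := @arg_minP _ _ _ i (fun j => 0 < (M1 *m w) j 0) ratio wi.
  have ratio0 : 0 <= ratio l by rewrite divr_ge0 ?(ltW wl)// subr_ge0 uP.1.
  have u'E j : (M1 *m (u + ratio l *: w)) j 0 = (M1 *m u) j 0 + ratio l * (M1 *m w) j 0.
    by rewrite mulmxDr -scalemxAr cV_addE cV_scaleE.
  have u'P : lin_sys M1 M2 d1 d2 (u + ratio l *: w).
    split; last by rewrite mulmxDr -scalemxAr w2 scaler0 addr0 uP.2.
    move=> j; rewrite u'E; have [wj|wj] := leP ((M1 *m w) j 0) 0.
      by rewrite (le_trans _ (uP.1 j))// gerDl mulr_ge0_le0.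
    by rewrite -lerBrDl -ler_pdivlMr// lmin.
  have sub : act u \proper act (u + ratio l *: w).
    apply/properP; split.
      by apply/fintype.subsetP => j ju; move: (ju); rewrite !inE u'E w1// mulr0 addr0.
    exists l; first by rewrite inE u'E divfK ?(gt_eqF wl)// subrKC.
    by apply: contraL wl => /w1 ->; rewrite ltxx.
  have := proper_card sub; rewrite uk ltnNge kmax//.
  by apply/asboolP; exists (u + ratio l *: w).
move=> v v1 v2; split=> // i; apply: le_trans (uP.1 i).
have vu2 : M2 *m (v - u) = 0 by rewrite mulmxBr v2 uP.2 subrr.
rewrite -subr_le0 -cV_subE -mulmxBr; apply: noray => // j ju.
by rewrite mulmxBr cV_subE v1//; move: ju; rewrite inE => /eqP ->; rewrite subrr.
Qed.

(** A minimal face is cut out by equations indexed by a set [T], and a pseudo-inverse gives a point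
    of it that depends linearly on the right-hand side. There are finitely many [T], hence a uniform
    constant. [D T] zeroes the rows outside [T], so that all these systems have the same shape. *)
Lemma lin_sys_bounded_solution p1 p2 r (M1 : 'M[R]_(p1, r)) (M2 : 'M[R]_(p2, r)) :
  exists2 C : R, 0 <= C & forall d1 d2, lin_sys M1 M2 d1 d2 !=set0 ->
   exists2 u, lin_sys M1 M2 d1 d2 u & linfnorm u <= C * linfnorm (col_mx d1 d2).
Proof.
pose D (T : {set 'I_p1}) : 'M[R]_p1 := diag_mx (\row_i (i \in T)%:R).
have DE p T (B : 'M[R]_(p1, p)) i j : (D T *m B) i j = (i \in T)%:R * B i j.
  by rewrite mul_diag_mx !mxE.
pose B T := col_mx (D T *m M1) M2.
pose Q T := (pinvmx (B T)^T)^T *m block_mx (D T) 0 0 1%:M.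
pose s T := \sum_i \sum_j `|Q T i j|.
have s0 T : 0 <= s T by rewrite sumr_ge0// => i _; rewrite sumr_ge0.
exists (\sum_T s T); first exact: sumr_ge0.
move=> d1 d2 /lin_sys_minimal_face[T [u [u1 u2 sub]]].
have Bu : B T *m u = block_mx (D T) 0 0 1%:M *m col_mx d1 d2.
  rewrite mul_block_col !mul0mx mul1mx addr0 add0r mul_col_mx u2; congr col_mx.
  apply/matrixP => i j; rewrite ord1 -mulmxA !DE; case: (boolP (i \in T)) => [/u1 ->//|_].
  by rewrite !mul0r.
exists (Q T *m col_mx d1 d2); last first.
  rewrite (le_trans (linf_mulmx _ _))// ler_wpM2r//.
  by rewrite [leRHS](bigD1 T)//= lerDl sumr_ge0.
have : B T *m (Q T *m col_mx d1 d2) = B T *m u.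
  rewrite -mulmxA -Bu; apply: trmx_inj; rewrite !trmx_mul !trmxK mulmxKpV//.
  exact: submxMl.
rewrite Bu mul_block_col !mul0mx mul1mx addr0 add0r mul_col_mx => /eq_col_mx[v1 v2].
apply: sub => // i iT; have := congr1 (fun X : 'cV_p1 => X i 0) v1.
by rewrite -mulmxA /= !DE iT !mul1r.
Qed.
End Polyhedra.

(** * Robinson's error bound *)

Section RobinsonBound.
Variable R : realType.

(** The l1 norm of the positive part, which measures the violation of [u <= 0]. *)
Definition pos_sum p (u : 'cV[R]_p) : R := \sum_i Num.max (u i 0) 0.

Let linf := @linfnorm R.
Let l2 := @l2norm R.

(** The set whose [sup] defines [robinson_mu] is bounded above, by [lin_sys_bounded_solution], so
    the supremum is genuine. *)
Lemma inf_le_robinson_mu p1 p2 r (M1 : 'M[R]_(p1, r)) (M2 : 'M[R]_(p2, r)) d1 d2 :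
  lin_sys M1 M2 d1 d2 !=set0 -> l2norm (col_mx d1 d2) <= 1 ->
  inf [set linf u | u in lin_sys M1 M2 d1 d2] <= robinson_mu linf l2 M1 M2.
Proof.
move=> d0 d1le; apply: ub_le_sup; last by exists (d1, d2).
have [C C0 MC] := lin_sys_bounded_solution M1 M2.
exists C => _ [[e1 e2] /= [/MC[u uP uC] ele] <-].
apply: (@le_trans _ _ (linf u)).
  by apply: ge_inf; [exists 0 => _ [v _ <-]; exact: normr_ge0|exists u].
rewrite (le_trans uC)// -[leRHS]mulr1 ler_wpM2l//.
exact: le_trans (linf_le_l2 _) ele.
Qed.

Lemma robinson_mu_le_sigma m1 m2 l (N1 : 'M[R]_(m1, l)) (N2 : 'M[R]_(m2, l))
    (S : {set 'I_m1}) :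
  robinson_mu linf l2 (block_mx (rowsub (fun i : 'I_#|S| => enum_val i) 1%:M) 0
                 (- 1%:M) 0 : 'M[R]_(#|S| + m1, m1 + m2)) (col_mx N1 N2)^T
  <= robinson_sigma linf l2 N1 N2.
Proof. exact: (le_bigmax_cond _ _ (j := S)). Qed.

Lemma robinson_sigma_ge0 m1 m2 l (N1 : 'M[R]_(m1, l)) (N2 : 'M[R]_(m2, l)) :
  0 <= robinson_sigma linf l2 N1 N2.
Proof. exact: bigmax_ge_id. Qed.

Lemma pos_sum_ge0 p (u : 'cV[R]_p) : 0 <= pos_sum u.
Proof. by apply: sumr_ge0 => i _; rewrite le_max lexx orbT. Qed.

Lemma linf_col_mxu p n (u : 'cV[R]_p) (v : 'cV[R]_n) : `|u| <= `|col_mx u v|.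
Proof.
apply: le_norm_matrix => // i j.
by rewrite ord1 -(col_mxEu u v) coord_le_linf.
Qed.

Lemma linf_col_mxd p n (u : 'cV[R]_p) (v : 'cV[R]_n) : `|v| <= `|col_mx u v|.
Proof.
apply: le_norm_matrix => // i j.
by rewrite ord1 -(col_mxEd u v) coord_le_linf.
Qed.

(* The residual direction at the projection of [z] lies in the normal cone;   *)
(* its multipliers solve the system defining [robinson_mu] for the index set  *)
(* of inactive constraints.                                                   *)
Lemma robinson_error_bound m1 m2 l (N1 : 'M[R]_(m1, l)) (N2 : 'M[R]_(m2, l)) b1 b2 z :
  lin_sys N1 N2 b1 b2 !=set0 ->
  exists2 zs, lin_sys N1 N2 b1 b2 zs &
    l2norm (z - zs) <= robinson_sigma linf l2 N1 N2 *
      (pos_sum (N1 *m z - b1) + l1norm (N2 *m z - b2)).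
Proof.
move=> P0.
have [I [h [hl hP]]] := lin_sys_setP N1 N2 b1 b2.
have [|||zs zsP zsmin] := lip_minimizer (f := fun u => l2norm (u - z))
    (b := `|z|) hl _ _.
- exact/lip_shift/sublinear_l2norm.
- move=> x; rewrite -{1}(subrK z x) (le_trans (ler_normD _ _))//.
  by rewrite lerD2r linf_le_l2.
- by have [x /hP xh] := P0; exists x.
have {}zsmin u : lin_sys N1 N2 b1 b2 u -> l2norm (zs - z) <= l2norm (u - z).
  by move=> /hP; exact: zsmin.
have {hP h hl I} zsP : lin_sys N1 N2 b1 b2 zs by apply/hP.
exists zs => //; set res := pos_sum _ + _; set sig := robinson_sigma _ _ _ _.
have res0 : 0 <= res by rewrite addr_ge0// ?pos_sum_ge0 ?l1norm_ge0.
have [g gdef] : exists g, g = z - zs by exists (z - zs).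
rewrite -gdef.
have [g0|gn0] := eqVneq (l2norm g) 0.
  by rewrite g0 mulr_ge0// robinson_sigma_ge0.
have gp : 0 < l2norm g by rewrite lt_neqAle eq_sym gn0 l2norm_ge0.
(* Variational inequality of the projection: otherwise a step from [zs] towards [u] would come
   closer to [z]. *)
have gmax u : lin_sys N1 N2 b1 b2 u -> dotv g u <= dotv g zs.
  move=> uP; rewrite -subr_le0 -dotvBr leNgt; apply/negP.
  have [w wdef] : exists w, w = u - zs by exists (u - zs).
  rewrite -wdef => gw.
  have conv t : 0 <= t <= 1 -> lin_sys N1 N2 b1 b2 (zs + t *: w).
    move=> /andP[t0 t1].
    have -> : zs + t *: w = (1 - t) *: zs + t *: u.
      by rewrite wdef scalerBl scale1r scalerBr addrAC addrA.
    have nt0 : 0 <= 1 - t by rewrite subr_ge0.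
    split=> [i|].
      rewrite mulmxDr -!scalemxAr cV_addE !cV_scaleE.
      have := uP.1 i; have := zsP.1 i; nra.
    by rewrite mulmxDr -!scalemxAr zsP.2 uP.2 -scalerDl subrK scale1r.
  have w0 : 0 <= dotv w w by exact: dotvv_ge0.
  (* For this [t] in ]0, 1] one has t |w|^2 <= a < 2a, so the squared distance |g|^2 - 2ta + t^2
     |w|^2 drops below |g|^2. *)
  set a := dotv g w in gw; pose t := a / (a + dotv w w).
  have a0 : 0 < a by [].
  have aw : 0 < a + dotv w w by rewrite ltr_pwDl.
  have t01 : 0 <= t <= 1.
    by rewrite divr_ge0 ?(ltW a0) ?(ltW aw)//= ler_pdivrMr// mul1r lerDl.
  have t0 : 0 < t by rewrite divr_gt0.
  have := zsmin _ (conv t t01).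
  rewrite -(@ler_pXn2r _ 2) ?nnegrE ?l2norm_ge0// -!dotvv.
  have -> : zs + t *: w - z = t *: w - g by rewrite gdef opprB addrA [zs + _]addrC.
  have -> : zs - z = - g by rewrite gdef opprB.
  rewrite dotvNl dotvNr opprK dotvBl !dotvBr !dotvZl !dotvZr (dotvC w g) -/a.
  have : t * (a + dotv w w) = a by rewrite divfK// gt_eqF.
  move: (dotv w w) w0 => W W0 ta; rewrite -subr_le0 => ineq.
  have : t * (a + a - t * W) <= 0 by lra.
  by rewrite pmulr_rle0//; nra.
have [u1 [u2 [u10 u1act gE]]] := lin_sys_normal_cone zsP gmax.
pose S : {set 'I_m1} := [set i | (N1 *m zs) i 0 < b1 i 0]%SET.
pose r := l2norm g.
pose M' := block_mx (rowsub (fun i : 'I_#|S| => enum_val i) 1%:M) 0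
                 (- 1%:M) 0 : 'M[R]_(#|S| + m1, m1 + m2).
have M'E (v1 : 'cV[R]_m1) (v2 : 'cV[R]_m2) :
   M' *m col_mx v1 v2 = col_mx (\col_(i < #|S|) v1 (enum_val i) 0) (- v1).
  rewrite mul_block_col !mul0mx !addr0 mulNmx mul1mx mul_rowsub_mx mul1mx; congr col_mx.
  by apply/matrixP => i j; rewrite !mxE ord1.
have rp : 0 < r^-1 by rewrite invr_gt0.
have sys0 : lin_sys M' (col_mx N1 N2)^T 0 (r^-1 *: g) (r^-1 *: col_mx u1 u2).
  split; last by rewrite -scalemxAr tr_col_mx mul_row_col -gE.
  move=> i; rewrite -scalemxAr M'E cV_scaleE [leRHS]mxE pmulr_rle0//.
  case: (split_ordP i) => j ->; rewrite ?col_mxEu ?col_mxEd mxE ?oppr_le0//.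
  by rewrite u1act//; have := enum_valP j; rewrite inE.
have nrm : l2norm (col_mx (0 : 'cV[R]_(#|S| + m1)) (r^-1 *: g)) <= 1.
  rewrite -(@ler_pXn2r _ 2) ?nnegrE ?l2norm_ge0// -dotvv dotv_col_mx dotv0l add0r.
  by rewrite dotvv l2normZ gtr0_norm// mulVf.
(* Pair the equation for g / r with g = z - zs. The part [v1] lives on active rows, where [N1 *m zs]
   equals [b1], so the pairing sees only the residual of [z]. As this holds for every solution [u],
   r / res is a lower bound of the infimum in [robinson_mu]. *)
have key u : lin_sys M' (col_mx N1 N2)^T 0 (r^-1 *: g) u -> r <= linf u * res.
  rewrite -[u]vsubmxK; set v1 := usubmx u; set v2 := dsubmx u.
  rewrite /lin_sys/= M'E tr_col_mx mul_row_col => -[uS ug].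
  have v1S i : (N1 *m zs) i 0 < b1 i 0 -> v1 i 0 <= 0.
    move=> Si; have iS : i \in S by rewrite inE.
    have := uS (lshift _ (enum_rank_in iS i)).
    by rewrite col_mxEu !mxE enum_rankK_in// mxE.
  have v10 i : 0 <= v1 i 0.
    by have := uS (rshift _ i); rewrite col_mxEd !mxE oppr_le0.
  have -> : r = dotv (r^-1 *: g) g.
    by rewrite dotvZl dotvv -/r expr2 mulKf.
  rewrite -ug dotvDl !dotv_mull !trmxK gdef !mulmxBr zsP.2 mulrDr; apply: lerD.
    rewrite dotvE mulr_sumr; apply: ler_sum => i _; rewrite !cV_subE.
    have v1u : v1 i 0 <= linf (col_mx v1 v2).
      exact: le_trans (le_trans (ler_norm _) (coord_le_linf _ _)) (linf_col_mxu _ _).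
    have [iS|iS] := ltP ((N1 *m zs) i 0) (b1 i 0).
      have -> : v1 i 0 = 0 by apply/eqP; rewrite eq_le v10 v1S.
      by rewrite mul0r mulr_ge0 ?normr_ge0// le_max lexx orbT.
    have -> : (N1 *m zs) i 0 = b1 i 0 by apply/eqP; rewrite eq_le iS zsP.1.
    apply: (@le_trans _ _ (v1 i 0 * Num.max ((N1 *m z) i 0 - b1 i 0) 0)).
      by rewrite ler_wpM2l// le_max lexx.
    by rewrite ler_wpM2r// le_max lexx orbT.
  rewrite (le_trans (dotv_le_linf_l1 _ _))// ler_wpM2r ?l1norm_ge0//.
  exact: linf_col_mxd.
have resp : 0 < res.
  rewrite lt_neqAle res0 andbT eq_sym; apply/eqP => re0.
  by have := key _ sys0; rewrite re0 mulr0 leNgt gp.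
rewrite -/r -ler_pdivrMr//.
apply: le_trans (robinson_mu_le_sigma N1 N2 S).
apply: le_trans (inf_le_robinson_mu _ nrm); last by exists (r^-1 *: col_mx u1 u2).
apply: lb_le_inf; first by exists (linf (r^-1 *: col_mx u1 u2)); exists (r^-1 *: col_mx u1 u2).
by move=> _ [u uP <-]; rewrite ler_pdivrMr// key.
Qed.
End RobinsonBound.

(** * The primal-dual system *)

Section PrimalDualSystem.
Variable R : realType.

Lemma le_vec_col_mx p r (a c : 'cV[R]_p) (b d : 'cV[R]_r) :
  le_vec (col_mx a b) (col_mx c d) <-> le_vec a c /\ le_vec b d.
Proof.
split=> [le|[ac bd] i].
  split=> i; first by have := le (lshift _ i); rewrite !col_mxEu.
  by have := le (rshift _ i); rewrite !col_mxEd.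
by case: (split_ordP i) => j ->; rewrite ?col_mxEu ?col_mxEd.
Qed.

Lemma le_vec_oppr0 p (u : 'cV[R]_p) : le_vec (- u) 0 <-> forall i, 0 <= u i 0.
Proof. by split=> le i; have := le i; rewrite !mxE oppr_le0. Qed.

Lemma pos_sum_col_mx p r (a : 'cV[R]_p) (b : 'cV[R]_r) :
  pos_sum (col_mx a b) = pos_sum a + pos_sum b.
Proof.
rewrite /pos_sum big_split_ord/=; congr (_ + _).
  by apply: eq_bigr => i _; rewrite col_mxEu.
by apply: eq_bigr => i _; rewrite col_mxEd.
Qed.

Lemma pos_sum_eq0 p (a b : 'cV[R]_p) : le_vec a b -> pos_sum (a - b) = 0.
Proof. by move=> ab; apply: big1 => i _; apply/max_idPr; rewrite cV_subE subr_le0. Qed.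

Lemma l1norm_col_mx p r (a : 'cV[R]_p) (b : 'cV[R]_r) :
  l1norm (col_mx a b) = l1norm a + l1norm b.
Proof.
rewrite /l1norm big_split_ord/=; congr (_ + _).
  by apply: eq_bigr => i _; rewrite col_mxEu.
by apply: eq_bigr => i _; rewrite col_mxEd.
Qed.

Lemma l1norm_scalar (a : R) : l1norm (a%:M : 'cV_1) = `|a|.
Proof. by rewrite /l1norm big_ord1 !mxE eqxx. Qed.

Lemma dotv_scalar n (u v : 'cV[R]_n) : u^T *m v = (dotv u v)%:M.
Proof. exact: mx11_scalar. Qed.

Definition absv n (x : 'cV[R]_n) : 'cV[R]_n := \col_i `|x i 0|.

Lemma dotv_const1 n (t : 'cV[R]_n) : dotv (const_mx 1) t = \sum_i t i 0.
Proof. by rewrite dotvE; apply: eq_bigr => i _; rewrite mxE mul1r. Qed.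

Lemma dotv_const1_absv n (x : 'cV[R]_n) : dotv (const_mx 1) (absv x) = l1norm x.
Proof. by rewrite dotv_const1; apply: eq_bigr => i _; rewrite mxE. Qed.

Lemma dotv_le n (u v w : 'cV[R]_n) :
  (forall i, 0 <= u i 0) -> le_vec v w -> dotv u v <= dotv u w.
Proof. by move=> u0 vw; rewrite !dotvE; apply: ler_sum => i _; rewrite ler_wpM2l. Qed.

(* [w1], [w2], [v] are the multipliers of [x <= t], [- x <= t], [G x <= b] in *)
(* the linear form [min 1^T t] of [min ||x||_1 : G x <= b].                   *)
Lemma l1_lp_duality n N (G : 'M[R]_(N, n)) (b : 'cV[R]_N) :
  (exists x, le_vec (G *m x) b) ->
  exists (x w1 w2 : 'cV[R]_n) (v : 'cV[R]_N),
   [/\ le_vec (G *m x) b,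
       [/\ forall i, 0 <= w1 i 0, forall i, 0 <= w2 i 0 & forall i, 0 <= v i 0],
       w1 + w2 = const_mx 1, w1 - w2 + G^T *m v = 0 &
       l1norm x + dotv b v = 0].
Proof.
move=> [x0 x0P].
have [||||x xb xmin] := lip_minimizer (I := 'I_N) (f := fun x => l1norm (x - 0))
    (h := fun i x => dotv (row i G)^T x + - b i 0) (b := 0) _ _ _.
- by move=> i; exact: lip_dotv.
- exact/lip_shift/sublinear_l1norm.
- by move=> x; rewrite subr0 addr0 linf_le_l1.
- by exists x0 => i; rewrite dotv_row subr_le0.
have {}xb : le_vec (G *m x) b by move=> i; have := xb i; rewrite dotv_row subr_le0.
have {}xmin u : le_vec (G *m u) b -> l1norm x <= l1norm u.
  move=> ub; have := xmin u; rewrite !subr0; apply=> i.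
  by rewrite dotv_row subr_le0.
pose N1 : 'M[R]_(n + (n + N), n + n) :=
  col_mx (row_mx 1%:M (- 1%:M)) (col_mx (row_mx (- 1%:M) (- 1%:M)) (row_mx G 0)).
pose N2 : 'M[R]_(0, n + n) := 0.
have N1E u t : N1 *m col_mx u t = col_mx (u - t) (col_mx (- u - t) (G *m u)).
  by rewrite !mul_col_mx !mul_row_col !mulNmx !mul1mx mul0mx addr0.
pose bb := col_mx (0 : 'cV[R]_n) (col_mx (0 : 'cV[R]_n) b).
have sysP u t : lin_sys N1 N2 bb 0 (col_mx u t) <->
    [/\ le_vec (u - t) 0, le_vec (- u - t) 0 & le_vec (G *m u) b].
  rewrite /lin_sys /= N1E !le_vec_col_mx; split=> [[[? [? ?]]]//|[? ? ?]].
  by split=> //; apply/matrixP => -[].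
(* Maximizing [g] over pairs (x, t) is minimizing 1^T t. *)
pose g : 'cV[R]_(n + n) := col_mx 0 (- const_mx 1).
have zP : lin_sys N1 N2 bb 0 (col_mx x (absv x)).
  apply/sysP; split=> // i; rewrite !mxE subr_le0 ?ler_norm//.
  by rewrite -normrN ler_norm.
have gmax u : lin_sys N1 N2 bb 0 u -> dotv g u <= dotv g (col_mx x (absv x)).
  rewrite -[u]vsubmxK; move: (usubmx u) (dsubmx u) => {}u t /sysP[ut nut ub].
  rewrite !dotv_col_mx !dotv0l !add0r !dotvNl lerN2 dotv_const1_absv dotv_const1.
  apply: (le_trans (xmin _ ub)); apply: ler_sum => i _.
  have := ut i; have := nut i; rewrite !mxE ler_norml => *; lra.
have [la [mu [la0 lact]]] := lin_sys_normal_cone zP gmax.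
rewrite -[la]vsubmxK -[dsubmx la]vsubmxK in la0 lact *.
move: (usubmx la) (usubmx (dsubmx la)) (dsubmx (dsubmx la)) la0 lact => w1 w2 v la0 lact.
rewrite [N2^T](_ : _ = 0) ?mul0mx ?addr0; last by apply/matrixP => i [].
rewrite !tr_col_mx !tr_row_mx !mul_row_col !mul_col_mx !trmx0 !mul0mx.
rewrite !linearN/= !trmx1 !mulNmx !mul1mx !add_col_mx addr0.
move=> /eq_col_mx[e1 e2].
have w10 i : 0 <= w1 i 0 by have := la0 (lshift _ i); rewrite col_mxEu.
have w20 i : 0 <= w2 i 0.
  by have := la0 (rshift _ (lshift _ i)); rewrite col_mxEd col_mxEu.
have v0 i : 0 <= v i 0.
  by have := la0 (rshift _ (rshift _ i)); rewrite !col_mxEd.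
(* Complementary slackness for the three blocks; it makes the duality gap vanish at the end. *)
have c1 i : w1 i 0 * (x i 0 - `|x i 0|) = 0.
  have := lact (lshift _ i); rewrite N1E !col_mxEu !mxE subr_lt0.
  have [<-|ne ->] := eqVneq (x i 0) `|x i 0|; first by rewrite subrr mulr0.
    by rewrite mul0r.
  by rewrite lt_neqAle ne ler_norm.
have c2 i : w2 i 0 * (- x i 0 - `|x i 0|) = 0.
  have := lact (rshift _ (lshift _ i)); rewrite N1E !col_mxEd !col_mxEu !mxE subr_lt0.
  have [<-|ne ->] := eqVneq (- x i 0) `|x i 0|; first by rewrite subrr mulr0.
    by rewrite mul0r.
  by rewrite lt_neqAle ne -normrN ler_norm.
have c3 : dotv v (G *m x) = dotv v b.
  rewrite !dotvE; apply: eq_bigr => i _.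
  have := lact (rshift _ (rshift _ i)); rewrite N1E !col_mxEd.
  have [->//|ne ->] := eqVneq ((G *m x) i 0) (b i 0); first by rewrite !mul0r.
  by rewrite lt_neqAle ne xb.
have w12 : w1 + w2 = const_mx 1 by apply: oppr_inj; rewrite e2 opprD.
exists x, w1, w2, v; split=> //; first by rewrite e1 addrA.
rewrite -dotv_const1_absv -w12 (dotvC b) -c3 dotv_mulr dotvDl.
have -> : G^T *m v = w2 - w1.
  by move: e1 => /esym/eqP; rewrite addrA addrC addr_eq0 opprB => /eqP.
rewrite dotvBl !dotvE -!big_split -sumrB -big_split big1// => i _.
by have := c1 i; have := c2 i; rewrite !mxE /=; lra.
Qed.

(** * Optimality system of the relaxed linear program *)

Section MbarSystem.
Variables (m n q N : nat).
Variables (A : 'M[R]_(m, n)) (M : 'M[R]_(m, q)) (y : 'cV[R]_m) (tau : R).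
Variable Gamma : 'M[R]_(q, N).

Let G := (M *m Gamma)^T *m A.

(** With this right-hand side, G x <= b says that a^T M^T (A x - y) <= tau for every column a of
    [Gamma]; see [relax_slack]. *)
Definition relax_rhs : 'cV[R]_N := tau *: const_mx 1 + (M *m Gamma)^T *m y.
Let b := relax_rhs.

Definition col5 (x t w1 w2 : 'cV[R]_n) (v : 'cV[R]_N) :=
  col_mx x (col_mx t (col_mx w1 (col_mx w2 v))).

Lemma col5_surj (z : 'cV[R]_(n + (n + (n + (n + N))))) :
  exists x t w1 w2 v, z = col5 x t w1 w2 v.
Proof.
exists (usubmx z), (usubmx (dsubmx z)), (usubmx (dsubmx (dsubmx z))).
exists (usubmx (dsubmx (dsubmx (dsubmx z)))), (dsubmx (dsubmx (dsubmx (dsubmx z)))).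
by rewrite /col5 !vsubmxK.
Qed.

Definition Mbar_rhs : 'cV[R]_(n + (n + (n + (N + (n + (n + (n + N))))))) :=
  col_mx 0 (col_mx 0 (col_mx (const_mx 1) (col_mx b (col_mx 0 (col_mx 0 (col_mx 0 0)))))).

Definition opt_sys := lin_sys (Mbar1 A M Gamma) (Mbar2 A M y tau Gamma) Mbar_rhs 0.

Lemma row5_mul p (B1 B2 B3 B4 : 'M[R]_(p, n)) (B5 : 'M[R]_(p, N)) x t w1 w2 v :
  row5 B1 B2 B3 B4 B5 *m col5 x t w1 w2 v =
  B1 *m x + (B2 *m t + (B3 *m w1 + (B4 *m w2 + B5 *m v))).
Proof. by rewrite /row5 /col5 !mul_row_col. Qed.

Lemma Mbar1_mul x t w1 w2 v : Mbar1 A M Gamma *m col5 x t w1 w2 v =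
  col_mx (x - t) (col_mx (- x - t) (col_mx (w1 + w2) (col_mx (G *m x)
    (col_mx (- t) (col_mx (- w1) (col_mx (- w2) (- v))))))).
Proof.
by rewrite /Mbar1 !mul_col_mx !row5_mul !mulNmx !mul1mx !mul0mx !addr0 !add0r.
Qed.

Lemma Mbar2_mul x t w1 w2 v : Mbar2 A M y tau Gamma *m col5 x t w1 w2 v =
  col_mx (w1 - w2 + G^T *m v) ((dotv (const_mx 1) t + dotv b v)%:M).
Proof.
rewrite /Mbar2 !mul_col_mx !row5_mul !mulNmx !mul1mx !mul0mx !add0r addrA.
congr col_mx; first by rewrite /G trmx_mul trmxK mulmxA.
rewrite raddfD /= -!dotv_scalar trmx_const; congr (_ + (_ *m _)).
by rewrite linearD linearZ/= trmx_const trmx_mul trmxK mulmxA.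
Qed.

Lemma opt_sysP x t w1 w2 v : opt_sys (col5 x t w1 w2 v) <->
  [/\ le_vec (G *m x) b,
    [/\ le_vec (x - t) 0, le_vec (- x - t) 0, le_vec (w1 + w2) (const_mx 1)
      & forall i, 0 <= t i 0],
    [/\ forall i, 0 <= w1 i 0, forall i, 0 <= w2 i 0 & forall i, 0 <= v i 0],
    w1 - w2 + G^T *m v = 0 & dotv (const_mx 1) t + dotv b v = 0].
Proof.
rewrite /opt_sys /lin_sys /= Mbar1_mul Mbar2_mul !le_vec_col_mx !le_vec_oppr0.
split=> [[[? [? [? [? [? [? []]]]]]]]|[? [? ? ? ?] [? ? ?] -> ->]].
  rewrite -[0 in RHS]col_mx0 => ? ? /eq_col_mx[? /matrixP/(_ 0 0)].
  by rewrite !mxE.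
by split; [do !split|rewrite raddf0 col_mx0].
Qed.

Lemma opt_sys_nonempty : (exists x, le_vec (G *m x) b) -> opt_sys !=set0.
Proof.
move=> /l1_lp_duality[x [w1 [w2 [v [xb w0 w12 wv xv]]]]].
exists (col5 x (absv x) w1 w2 v); apply/opt_sysP; split=> //.
  split=> [i|i|i|i]; rewrite ?w12// !mxE ?subr_le0 ?ler_norm//.
  by rewrite -normrN ler_norm.
by rewrite dotv_const1_absv.
Qed.

(** ||x||_1 <= 1^T t = - b^T v <= - v^T G u = (w1 - w2)^T u <= ||u||_1, the last step because w1, w2
    >= 0 and w1 + w2 <= 1. *)
Lemma opt_sys_weak_duality x t w1 w2 v u :
  opt_sys (col5 x t w1 w2 v) -> le_vec (G *m u) b -> l1norm x <= l1norm u.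
Proof.
move=> /opt_sysP[_ [xt nxt w12 _] [w10 w20 v0] wv tv] ub.
apply: (@le_trans _ _ (dotv (const_mx 1) t)).
  rewrite dotv_const1; apply: ler_sum => i _.
  by have := xt i; have := nxt i; rewrite !mxE ler_norml => *; lra.
have -> : dotv (const_mx 1) t = - dotv v b by apply/eqP; rewrite -addr_eq0 (dotvC v) tv.
apply: (@le_trans _ _ (- dotv v (G *m u))); first by rewrite lerN2 dotv_le.
rewrite dotv_mulr -dotvNl.
have -> : - (G^T *m v) = w1 - w2 by apply/esym/eqP; rewrite -addr_eq0 wv.
rewrite dotvE; apply: ler_sum => i _; rewrite cV_subE.
have := w12 i; rewrite !mxE => wi; have := w10 i; have := w20 i => w2i w1i.
rewrite (le_trans (ler_norm _))// normrM -[leRHS]mul1r ler_wpM2r//.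
by rewrite ler_norml; apply/andP; split; lra.
Qed.

(** For a dual feasible point with t = |x|, all blocks but G x <= b and the duality gap are
    satisfied. *)
Lemma opt_sys_residual (x w1 w2 : 'cV[R]_n) (v : 'cV[R]_N) :
  (forall i, 0 <= w1 i 0) -> (forall i, 0 <= w2 i 0) -> (forall i, 0 <= v i 0) ->
  le_vec (w1 + w2) (const_mx 1) -> w1 - w2 + G^T *m v = 0 ->
  let z := col5 x (absv x) w1 w2 v in
  pos_sum (Mbar1 A M Gamma *m z - Mbar_rhs) + l1norm (Mbar2 A M y tau Gamma *m z - 0)
  = pos_sum (G *m x - b) + `|l1norm x + dotv b v|.
Proof.
move=> w10 w20 v0 w12 wv /=.
rewrite Mbar1_mul Mbar2_mul wv dotv_const1_absv subr0 l1norm_col_mx l1norm_scalar.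
rewrite /Mbar_rhs !opp_col_mx !add_col_mx !pos_sum_col_mx.
have -> : l1norm (0 : 'cV[R]_n) = 0 by apply: big1 => i _; rewrite mxE normr0.
have p1 : pos_sum (x - absv x - 0) = 0.
  by apply: pos_sum_eq0 => i; rewrite !mxE subr_le0 ler_norm.
have p2 : pos_sum (- x - absv x - 0) = 0.
  by apply: pos_sum_eq0 => i; rewrite !mxE subr_le0 -normrN ler_norm.
have p3 p (u : 'cV[R]_p) : (forall i, 0 <= u i 0) -> pos_sum (- u - 0) = 0.
  by move=> u0; apply: pos_sum_eq0; apply/le_vec_oppr0.
rewrite p1 p2 (pos_sum_eq0 w12) !p3// => [|i]; last by rewrite mxE.
by rewrite !add0r !addr0.
Qed.

End MbarSystem.

End PrimalDualSystem.

(** * Certificates from the weak RSP and from the dual norm *)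

Section Certificates.
Variable R : realType.

Lemma best_kterm_err_ge0 n k (x : 'cV[R]_n) : 0 <= best_kterm_err k x.
Proof.
apply: lb_le_inf; last by move=> _ [u _ <-]; exact: l1norm_ge0.
exists (l1norm (x - 0)), 0 => //=; rewrite /l0norm.
by rewrite (_ : [set _ | _]%SET = finset.set0) ?cards0//; apply/setP => i; rewrite !inE mxE eqxx.
Qed.

(** Take [S] with the smallest tail. For a k-sparse [u], the tail of [x] off the support of [u] is
    part of ||x - u||_1. *)
Lemma best_kterm_support n k (x : 'cV[R]_n) :
  exists2 S : {set 'I_n}, (#|S| <= k)%N &
    \sum_(i | i \notin S) `|x i 0| <= best_kterm_err k x.
Proof.
pose tail (S : {set 'I_n}) := \sum_(i | i \notin S) `|x i 0|.
have k0 : (#|finset.set0 : {set 'I_n}| <= k)%N by rewrite cards0.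
have [S Sk Smin] := @arg_minP _ _ _ _ (fun S : {set 'I_n} => (#|S| <= k)%N) tail k0.
exists S => //; apply: lb_le_inf.
  exists (l1norm (x - 0)), 0 => //=; rewrite /l0norm.
  by rewrite (_ : [set _ | _]%SET = finset.set0) //; apply/setP => i; rewrite !inE mxE eqxx.
move=> _ [u /= uk <-]; apply: le_trans (Smin _ uk) _.
rewrite /tail /l1norm big_mkcond; apply: ler_sum => i _.
by rewrite inE negbK; case: eqP => [ui|//]; rewrite cV_subE ui subr0.
Qed.

(** Apply the weak RSP to the sign pattern of [x] on a best k-term support. The difference |x_i| -
    x_i zeta_i is 0 on the support and at most 2 |x_i| off it. *)
Lemma weak_RSP_certificate m n k (A : 'M[R]_(m, n)) (x : 'cV[R]_n) :
  weak_RSP k A^T ->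
  exists u, [/\ linfnorm (A^T *m u) <= 1, dotv x (A^T *m u) <= l1norm x &
    l1norm x - dotv x (A^T *m u) <= 2 * best_kterm_err k x].
Proof.
move=> rsp; have [S Sk Sx] := best_kterm_support k x.
pose S1 := [set i in S | 0 < x i 0]%SET; pose S2 := [set i in S | x i 0 < 0]%SET.
have dis : [disjoint S1 & S2]%bool.
  rewrite -setI_eq0; apply/eqP/setP => i; rewrite !inE.
  by case: ltgtP; rewrite ?andbF.
have card12 : (#|S1| + #|S2| <= k)%N.
  rewrite -cardsUI (_ : S1 :&: S2 = finset.set0)%SET; last by apply/eqP; rewrite setI_eq0.
  rewrite cards0 addn0 (leq_trans _ Sk)// subset_leq_card//.
  by apply/fintype.subsetP => i; rewrite !inE -andb_orr => /andP[].
have [ze [[u zeE] ze1 ze2 ze3]] := rsp S1 S2 dis card12.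
exists u; rewrite -zeE.
have zei i : `|ze i 0| <= 1.
  case: (boolP (i \in S1)) => [/ze1 ->|i1]; first by rewrite normr1.
  case: (boolP (i \in S2)) => [/ze2 ->|i2]; first by rewrite normrN1.
  by apply: ze3; rewrite finset.in_setU negb_or i1.
have xzei i : `|x i 0 * ze i 0| <= `|x i 0| by rewrite normrM ler_piMr.
split.
- by apply: le_norm_matrix => // i j; rewrite ord1.
- rewrite dotvE; apply: ler_sum => i _; exact: le_trans (ler_norm _) (xzei i).
apply: le_trans (_ : 2 * \sum_(i | i \notin S) `|x i 0| <= _); last by rewrite ler_pM2l.
rewrite dotvE /l1norm -sumrB mulr_sumr [leRHS]big_mkcond; apply: ler_sum => i _.
case: ifPn => iS.
  by have := xzei i; rewrite ler_norml => /andP[h _]; lra.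
rewrite negbK in iS; have [x0|x0|x0] := ltgtP (x i 0) 0.
- by rewrite ze2 ?inE ?iS// ltr0_norm// mulrN1 subrr.
- by rewrite ze1 ?inE ?iS// gtr0_norm// mulr1 subrr.
- by rewrite x0 normr0 mul0r subrr.
Qed.

Lemma l1norm_mul_le p n (Q : 'M[R]_(p, n)) (x : 'cV[R]_n) :
  linfnorm x <= 1 -> l1norm (Q *m x) <= norm_inf_to_1 Q.
Proof.
move=> x1; apply: ub_le_sup; last by exists x.
exists (\sum_i \sum_j `|Q i j|) => _ [z /= z1 <-].
apply: ler_sum => i _; rewrite mxE (le_trans (ler_norm_sum _ _ _))//.
apply: ler_sum => j _; rewrite normrM ler_piMr//.
exact: le_trans (coord_le_linf _ _) z1.
Qed.

Lemma unitmx_ker0 p (B : 'M[R]_p) :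
  (forall v : 'rV[R]_p, v *m B = 0 -> v = 0) -> B \in unitmx.
Proof.
move=> B0; rewrite -row_free_unit -kermx_eq0; apply/rowV0P => v /sub_kermxP; exact: B0.
Qed.

Lemma row_free_ker0 p n (B : 'M[R]_(p, n)) (v : 'rV[R]_p) :
  \rank B = p -> v *m B = 0 -> v = 0.
Proof.
move=> rB vB; have : row_free B by rewrite /row_free rB eqxx.
by rewrite -kermx_eq0 => /rowV0P; apply; apply/sub_kermxP.
Qed.

Lemma mulmx_tr_unit m n (A : 'M[R]_(m, n)) : \rank A = m -> A *m A^T \in unitmx.
Proof.
move=> rA; apply: unitmx_ker0 => v vAA; apply: (row_free_ker0 rA).
apply: trmx_inj; rewrite trmx0; apply: dotvv_eq0.
by rewrite /dotv trmxK trmx_mul mulmxA -(mulmxA v) vAA mul0mx mxE.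
Qed.

(** Unfolds [conform_mx]: for [G] of size [m] it is a mere cast, and [colsubG] a true selection of
    columns. *)
Lemma colsubG_colsub m q (M : 'M[R]_(m, q)) (G : {set 'I_q}) : #|G| = m ->
  exists2 h : 'I_m -> 'I_q, colsubG M G = colsub h M &
    forall j, j \in G -> exists i, h i = j.
Proof.
move=> Gm; exists (fun i => enum_val (cast_ord (esym Gm) i)).
  have conformE p (e : p = m) (B : 'M[R]_(m, p)) :
      conform_mx (0 : 'M[R]_m) B = castmx (erefl, e) B.
    by subst p; rewrite conform_mx_id castmx_id.
  by apply/matrixP => i j; rewrite /colsubG (conformE _ Gm) castmxE !mxE cast_ord_id.
move=> j jG; exists (cast_ord Gm (enum_rank_in jG j)).
by rewrite cast_ordK enum_rankK_in.
Qed.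

Lemma cst_c_ge0 m n q (A : 'M[R]_(m, n)) (M : 'M[R]_(m, q)) : 0 <= cst_c A M.
Proof. exact: bigmax_ge_id. Qed.

(** Choose m independent columns G of M and g = M_G^-1 u. Since u = (A A^T)^-1 A (A^T u), g is the
    image of a vector of max norm at most 1 under one of the matrices that define c. *)
Lemma cst_c_solution m n q (A : 'M[R]_(m, n)) (M : 'M[R]_(m, q)) (u : 'cV[R]_m) :
  \rank A = m -> \rank M = m -> linfnorm (A^T *m u) <= 1 ->
  exists (h : 'I_m -> 'I_q) (g : 'cV[R]_m),
    colsub h M *m g = u /\ l1norm g <= cst_c A M.
Proof.
move=> rA rM u1.
have fM : row_full M^T by rewrite /row_full mxrank_tr rM.
pose f := fullrankfun fM; pose G := [set f i | i in 'I_m]%SET.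
have Gm : #|G| = m by rewrite card_imset ?card_ord//; exact: fullrankfun_inj.
have [h MG hG] := colsubG_colsub M Gm.
have uG : colsubG M G \in unitmx.
  rewrite MG; apply: unitmx_ker0 => v vM.
  (* [f] and [h] list the columns in G in possibly different orders, so invertibility is transferred
     through the left kernel. *)
  have : v *m colsub f M = 0.
    apply/matrixP => i j; rewrite ord1.
    have [l hl] : exists l, h l = f j by apply: hG; apply/imsetP; exists j.
    have := congr1 (fun X : 'rV[R]_m => X 0 l) vM; rewrite !mxE; apply: etrans.
    by apply: eq_bigr => e _; rewrite !mxE hl.
  have : (colsub f M)^T \in unitmx.
    rewrite (_ : _^T = rowsub f M^T) ?fullrowsub_unit//.
    by apply/matrixP => i j; rewrite !mxE.
  by rewrite unitmx_tr => fu vf; rewrite -[v](mulmxK fu) vf mul0mx.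
exists h, (invmx (colsubG M G) *m u); split; first by rewrite -MG mulKVmx.
apply: le_trans (_ : norm_inf_to_1 (invmx (colsubG M G) *m invmx (A *m A^T) *m A) <= _).
  apply: le_trans (l1norm_mul_le _ u1).
  by rewrite -!mulmxA (mulmxA A) (mulKmx (mulmx_tr_unit rA)).
apply: (le_bigmax_cond _ (fun G => norm_inf_to_1 (invmx (colsubG M G) *m invmx (A *m A^T) *m A))).
by rewrite Gm eqxx.
Qed.

Lemma is_norm_sublinear n (phi : 'cV[R]_n -> R) : is_norm phi -> sublinear phi.
Proof. by case=> _ fZ fD. Qed.

(* [sup] is 0 on sets without upper bound, so that a dual norm equal to 1     *)
(* is a genuine supremum.                                                     *)
Lemma dual_norm1_le n (phi : 'cV[R]_n -> R) a z :
  is_norm phi -> dual_norm phi a = 1 -> dotv a z <= phi z.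
Proof.
move=> phiN a1; have phiS := is_norm_sublinear phiN; have [phi0 phiZ phiD] := phiN.
have [z0|z0] := eqVneq (phi z) 0; first by rewrite z0 (phi0 _ z0) dotv0r.
have zp : 0 < phi z by rewrite lt_neqAle eq_sym z0 sublinear_ge0.
have hs : has_sup [set dotv a x | x in unit_ball phi].
  by apply: contrapT => /sup_out s0; move: a1; rewrite /dual_norm s0 => /esym/eqP; rewrite oner_eq0.
have := ub_le_sup hs.2 (x := dotv a ((phi z)^-1 *: z)).
rewrite -/(dual_norm phi a) a1 dotvZr ler_pdivrMl// mulr1; apply.
exists ((phi z)^-1 *: z); rewrite ?dotvZr//.
by rewrite /unit_ball/= phiZ gtr0_norm ?invr_gt0// mulVf.
Qed.

(** Every normal has dual norm 1: facet normals by their scaling, the vectors e_i by hypothesis, and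
    - e_i by symmetry of [phi]. *)
Lemma Qnormals_le q (phi : 'cV[R]_q -> R) P eps j a z :
  is_norm phi -> (forall i, dual_norm phi (stdvec i) = 1) ->
  Qnormals phi P eps j a -> dotv a z <= phi z.
Proof.
move=> phiN phie [[i _ [_ /dual_norm1_le]]|[i [->|->]]]; first exact.
  exact: dual_norm1_le.
by rewrite dotvNl -dotvNr -(sublinearN z (is_norm_sublinear phiN)) dual_norm1_le.
Qed.

Lemma Qpoly_halfspaces q (phi : 'cV[R]_q -> R) P eps j z :
  (forall a, Qnormals phi P eps j a -> dotv a z <= 1) -> Qpoly phi P eps j z.
Proof. by move=> Qz i ij; split=> a aP; apply: Qz; [left; exists i|right]. Qed.

End Certificates.

(** * The relaxation of (P) *)

Section ProblemP.
Variables (R : realType) (m n q N : nat).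
Variables (A : 'M[R]_(m, n)) (M : 'M[R]_(m, q)) (y : 'cV[R]_m) (tau : R).
Variables (phi : 'cV[R]_q -> R) (Gamma : 'M[R]_(q, N)).
Hypothesis rankA : \rank A = m.
Hypothesis tau_gt0 : 0 < tau.
Hypothesis phi_norm : is_norm phi.

Let phiS : sublinear phi := is_norm_sublinear phi_norm.
Let phires x := phi (M^T *m (A *m x - y)).

Lemma sol_set_opt x : sol_set A M y tau phi x -> opt_solution A M y tau phi x.
Proof.
move=> [xle xf]; split=> // z zf; apply: le_trans xle _; apply: ge_inf; last by exists z.
by exists 0 => _ [u _ <-]; exact: l1norm_ge0.
Qed.

Lemma phires_lip : lip (fun x => phires x - tau).
Proof.
have [C fC] := lip_affine (M^T *m A) (M^T *m y) (- tau) phiS.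
by exists C => u v; have := fC u v; rewrite -!mulmxA -!mulmxBr.
Qed.

(** Full row rank makes A^T (A A^T)^-1 y an exact solution of A x = y, hence feasible, and the l1
    norm is coercive. *)
Lemma sol_set_nonempty : sol_set A M y tau phi !=set0.
Proof.
have x0f : feasible A M y tau phi (A^T *m (invmx (A *m A^T) *m y)).
  rewrite /feasible /resid /= !mulmxA mulmxV ?mulmx_tr_unit// mul1mx subrr mulmx0.
  by rewrite sublinear0// ltW.
have [||||x xf xmin] := lip_minimizer (I := unit) (h := fun _ x => phires x - tau)
   (f := fun x => l1norm (x - 0)) (b := 0) _ _ _.
- by move=> _; exact: phires_lip.
- exact/lip_shift/sublinear_l1norm.
- by move=> x; rewrite addr0 subr0 linf_le_l1.
- by exists (A^T *m (invmx (A *m A^T) *m y)) => _; rewrite subr_le0.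
have {}xf : feasible A M y tau phi x by have := xf tt; rewrite subr_le0.
exists x; split=> //; apply: lb_le_inf; first by exists (l1norm x), x.
move=> _ [u uf <-]; have := xmin u; rewrite !subr0; apply=> _.
by rewrite subr_le0.
Qed.

Lemma sol_set_nearest z : exists2 xs, sol_set A M y tau phi xs &
  forall u, sol_set A M y tau phi u -> l2norm (xs - z) <= l2norm (u - z).
Proof.
have solP x : sol_set A M y tau phi x <->
    forall b : bool, (if b then phires x - tau else l1norm (x - 0) - opt_value A M y tau phi) <= 0.
  split=> [[x1 x2] []|xP]; rewrite ?subr0 ?subr_le0//.
  by split; [have := xP false|have := xP true]; rewrite ?subr0 subr_le0.
have [||||x /solP xs xmin] := lip_minimizer
   (h := fun (b : bool) x => if b then phires x - tau else l1norm (x - 0) - opt_value A M y tau phi)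
   (f := fun x => l2norm (x - z)) (b := `|z|) _ _ _.
- case; first exact: phires_lip.
  have [C lC] := lip_shift 0 (sublinear_l1norm R n).
  by exists C => u v; rewrite [leRHS]addrAC lerD2r.
- exact/lip_shift/sublinear_l2norm.
- move=> x; rewrite -{1}(subrK z x) (le_trans (ler_normD _ _))//.
  by rewrite lerD2r linf_le_l2.
- by have [x /solP xs] := sol_set_nonempty; exists x.
by exists x => // u /solP us; exact: xmin.
Qed.

(** The Hausdorff distance only bounds an infimum of distances; that the nearest point of [sol_set]
    exists gives the bound [delta] without loss. *)
Lemma hausdorff_nearest (O : set 'cV[R]_n) delta z :
  (hausdorff_dist (sol_set A M y tau phi) O <= delta%:E)%E -> O z ->
  exists2 xs, sol_set A M y tau phi xs & l2norm (xs - z) <= delta.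
Proof.
rewrite /hausdorff_dist ge_max => /andP[_ dO] Oz.
have [xs xsS xsmin] := sol_set_nearest z; exists xs => //.
rewrite -lee_fin; apply: le_trans dO; apply: le_trans (ereal_sup_ubound _); last by exists z.
by apply: le_ereal_inf_tmp => _ [u uS <-]; rewrite lee_fin xsmin.
Qed.

Lemma relax_slack x j :
  ((M *m Gamma)^T *m A *m x - relax_rhs M y tau Gamma) j 0 =
  dotv (col j Gamma) (M^T *m (A *m x - y)) - tau.
Proof.
rewrite -[Gamma in RHS]trmxK -tr_row dotv_row mulmxA -trmx_mul mulmxBr -mulmxA.
by rewrite !mxE; ring.
Qed.

Hypothesis Gamma_le : forall j z, dotv (col j Gamma) z <= phi z.

Lemma feasible_relax x : feasible A M y tau phi x ->
  le_vec ((M *m Gamma)^T *m A *m x) (relax_rhs M y tau Gamma).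
Proof.
move=> xf j; rewrite -subr_le0 -cV_subE relax_slack subr_le0.
exact: le_trans (Gamma_le _ _) xf.
Qed.

Hypothesis rankM : \rank M = m.
Hypothesis Gamma_box : forall i, (exists j, col j Gamma = stdvec i) /\
  (exists j, col j Gamma = - stdvec i).

(* The columns [e_i] and [- e_i] of [Gamma] carry the positive and negative   *)
(* parts of the solution given by [cst_c_solution].                           *)
Lemma Gamma_multiplier u : linfnorm (A^T *m u) <= 1 ->
  exists v : 'cV[R]_N, [/\ forall j, 0 <= v j 0, M *m Gamma *m v = u &
    dotv (const_mx 1) v <= cst_c A M].
Proof.
move=> /(cst_c_solution rankA rankM)[h [g [hg gc]]].
have [jp jpE] := choice (fun i => (Gamma_box (h i)).1).
have [jm jmE] := choice (fun i => (Gamma_box (h i)).2).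
pose v : 'cV[R]_N := \sum_i (Num.max (g i 0) 0 *: stdvec (jp i)
                              + Num.max (- g i 0) 0 *: stdvec (jm i)).
have max0 (t : R) : 0 <= Num.max t 0 by rewrite le_max lexx orbT.
have maxB (t : R) : Num.max t 0 - Num.max (- t) 0 = t.
  by rewrite /Num.max; case: ltP => t0; case: ltP => t1; lra.
have maxD (t : R) : Num.max t 0 + Num.max (- t) 0 = `|t|.
  rewrite /Num.max; case: ltP => t0; case: ltP => t1; try lra.
  - by rewrite ltr0_norm//; lra.
  - by rewrite ger0_norm//; lra.
  - by rewrite ger0_norm//; lra.
exists v; split.
- move=> j; rewrite summxE sumr_ge0// => i _.
  by rewrite cV_addE !cV_scaleE addr_ge0// mulr_ge0// mxE; case: (_ && _).
- rewrite -hg -mulmxA mulmx_sumr.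
  have GammaE i : Gamma *m (Num.max (g i 0) 0 *: stdvec (jp i)
      + Num.max (- g i 0) 0 *: stdvec (jm i)) = g i 0 *: stdvec (h i).
    rewrite mulmxDr -!scalemxAr -!colE jpE jmE scalerN -scalerBl.
    by rewrite maxB.
  rewrite (eq_bigr _ (fun i _ => GammaE i)) mulmx_sumr.
  apply/matrixP => i j; rewrite ord1 summxE mxE; apply: eq_bigr => l _.
  by rewrite -scalemxAr cV_scaleE -colE !mxE mulrC.
apply: le_trans gc; rewrite dotvC dotv_suml /l1norm; apply: ler_sum => i _.
rewrite dotvDl !dotvZl !dotv_stdvec !mxE !mulr1.
by rewrite maxD.
Qed.

Variable k : nat.
Hypothesis rsp : weak_RSP k A^T.

Lemma relaxed_error_bound x :
  exists z, [/\ le_vec ((M *m Gamma)^T *m A *m z) (relax_rhs M y tau Gamma),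
    forall u, feasible A M y tau phi u -> l1norm z <= l1norm u &
    l2norm (x - z) <= gamma_bar A M y tau Gamma *
      (N%:R * Num.max (phires x - tau) 0 + 2 * best_kterm_err k x
       + cst_c A M * tau + cst_c A M * phires x)].
Proof.
have [u [ze1 xze xzek]] := weak_RSP_certificate x rsp.
(* The sign comes from the dual equation w1 - w2 + G^T v = 0, where w1 - w2 is to be A^T u. *)
have [v [v0 vu vc]] : exists v : 'cV[R]_N, [/\ forall j, 0 <= v j 0,
    M *m Gamma *m v = - u & dotv (const_mx 1) v <= cst_c A M].
  by apply: Gamma_multiplier; rewrite mulmxN /linfnorm normrN.
have [ze zeE] : exists ze, ze = A^T *m u by exists (A^T *m u).
rewrite -zeE in ze1 xze xzek.
pose w1 := \col_i Num.max (ze i 0) 0; pose w2 := \col_i Num.max (- ze i 0) 0.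
have w10 i : 0 <= w1 i 0 by rewrite mxE le_max lexx orbT.
have w20 i : 0 <= w2 i 0 by rewrite mxE le_max lexx orbT.
have w12 : le_vec (w1 + w2) (const_mx 1).
  move=> i; rewrite !mxE; have := le_trans (coord_le_linf ze i) ze1.
  rewrite ler_norml /Num.max => /andP[? ?]; case: ltP => ?; case: ltP => ?; lra.
have w1v : w1 - w2 + ((M *m Gamma)^T *m A)^T *m v = 0.
  rewrite trmx_mul trmxK -mulmxA vu mulmxN -zeE; apply/matrixP => i j.
  rewrite ord1 !mxE /Num.max; case: ltP => ?; case: ltP => ?; lra.
have sys0 : opt_sys A M y tau Gamma !=set0.
  apply: opt_sys_nonempty; have [xo [_ xof]] := sol_set_nonempty.
  by exists xo; exact: feasible_relax.
have [z0 z0P bnd] := robinson_error_bound (col5 x (absv x) w1 w2 v) sys0.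
have [z [t [w1' [w2' [v' z0E]]]]] := col5_surj z0.
rewrite z0E in z0P bnd.
exists z; split.
- by have /opt_sysP[] := z0P.
- by move=> u' /feasible_relax; exact: opt_sys_weak_duality z0P.
move: bnd; rewrite opt_sys_residual// => bnd.
apply: le_trans (le_trans bnd _).
  by rewrite /col5 opp_col_mx add_col_mx l2norm_col_mx.
apply: ler_wpM2l; first exact: robinson_sigma_ge0.
rewrite -!addrA; apply: lerD.
  rewrite /pos_sum -[N in N%:R]card_ord mulr_natl -sumr_const; apply: ler_sum => j _.
  rewrite relax_slack ge_max le_max lerD2r Gamma_le/=.
  by rewrite le_max lexx orbT.
have s0 : 0 <= dotv (const_mx 1) v by rewrite dotv_const1 sumr_ge0.
have phi0 : 0 <= phires x by exact: (sublinear_ge0 _ phiS).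
(* Uses y^T u = x^T A^T u - (A x - y)^T u, which brings out the term x^T zeta controlled by the
   certificate. *)
have rhsE : dotv (relax_rhs M y tau Gamma) v =
    tau * dotv (const_mx 1) v - dotv x ze + dotv (A *m x - y) u.
  rewrite dotvDl dotvZl dotv_mull trmxK vu dotvNr dotvBl dotv_mull -zeE; ring.
(* As - u = M Gamma v, the pairing is a combination with weights v_j of terms a_j^T M^T r, each at
   most phi(M^T r); applying this to r and - r gives both signs. *)
have gap : `|dotv (A *m x - y) u| <= phires x * dotv (const_mx 1) v.
  have bndr r : dotv r (M *m Gamma *m v) <= phi (M^T *m r) * dotv (const_mx 1) v.
    rewrite -mulmxA dotv_mulr dotv_mulr dotvC dotv_const1 mulr_sumr dotvE.
    apply: ler_sum => j _; rewrite mulrC ler_wpM2r//.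
    by rewrite -dotv_row -tr_col trmxK Gamma_le.
  rewrite ler_norml lerNl; apply/andP; split.
    by rewrite -dotvNr -vu bndr.
  rewrite -[u]opprK -vu dotvNr -dotvNl (le_trans (bndr _))//.
  by rewrite mulmxN sublinearN.
rewrite rhsE ler_norml; move: gap; rewrite ler_norml => /andP[g1 g2].
have c1 : tau * dotv (const_mx 1) v <= cst_c A M * tau by rewrite mulrC ler_wpM2r// ltW.
have c2 : phires x * dotv (const_mx 1) v <= cst_c A M * phires x by rewrite mulrC ler_wpM2r.
have c3 : 0 <= tau * dotv (const_mx 1) v by rewrite mulr_ge0// ltW.
by apply/andP; split; lra.
Qed.

End ProblemP.

(** * From the relaxation back to (P) *)

Unset Implicit Arguments.

Theorem theorem4p5 (R : realType) (m n q k : nat)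
  (A : 'M[R]_(m, n)) (M : 'M[R]_(m, q)) (y : 'cV[R]_m) (tau : R)
  (phi : 'cV[R]_q -> R)
  (chi eps0 : R) (P : R -> set 'cV[R]_q) (eps : nat -> R)
  (delta : R) (j0 : nat) (nhat : nat) (Gamma : 'M[R]_(q, nhat))
  (lt_mn : (m < n)%N) (le_mq : (m <= q)%N)
  (rankA : \rank A = m) (rankM : \rank M = m)
  (tau_gt0 : 0 < tau)
  (phi_norm : is_norm phi)
  (phi_e : forall i : 'I_q, phi (stdvec i) = 1)
  (phi_dual_e : forall i : 'I_q, dual_norm phi (stdvec i) = 1)
  (chi_gt : expR 1 / (4 * Num.sqrt 2) < chi)
  (eps0_gt0 : 0 < eps0)
  (P_family : barvinok_family phi chi eps0 P)
  (eps_range : forall j, 0 < eps j < eps0)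
  (eps_decr : decreasing_seq eps)
  (eps_cvg0 : eps j @[j --> \oo] --> (0 : R))
  (Gamma_cols : columns_enumerate Gamma (Qnormals phi P eps j0))
  (delta_range : 0 < delta < tau)
  (j0_close : (hausdorff_dist (sol_set A M y tau phi)
                 (relaxed_set A M y tau phi (Qpoly phi P eps j0))
               <= delta%:E)%E)
  (rsp : weak_RSP k A^T) :
  let c := cst_c A M in
  let gam := gamma_bar A M y tau Gamma in
  let phires := fun x => phi (M^T *m (A *m x - y)) in
  (forall x : 'cV[R]_n, exists2 xs : 'cV[R]_n,
     opt_solution A M y tau phi xs &
     l2norm (x - xs) <=
       delta + 2 * gam * (nhat%:R * Num.max (phires x - tau) 0
                          + 2 * best_kterm_err k x
                          + c * tau + c * phires x)) /\
  (forall x : 'cV[R]_n, feasible A M y tau phi x ->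
   exists2 xs : 'cV[R]_n,
     opt_solution A M y tau phi xs &
     l2norm (x - xs) <=
       delta + 2 * gam * (2 * best_kterm_err k x + c * tau + c * phires x)
     /\
     delta + 2 * gam * (2 * best_kterm_err k x + c * tau + c * phires x) <=
       delta + 4 * gam * (best_kterm_err k x + c * tau)).
Proof.
move=> c gam phires; have [Gamma_inj Gamma_range] := Gamma_cols.
have Gamma_le j z : dotv (col j Gamma) z <= phi z.
  apply: (Qnormals_le (P := P) (eps := eps) (j := j0) z phi_norm phi_dual_e).
  by rewrite -Gamma_range; exists j.
have box i : (exists j, col j Gamma = stdvec i) /\ (exists j, col j Gamma = - stdvec i).
  have rangeP a : Qnormals phi P eps j0 a -> exists j, col j Gamma = a.
    by rewrite -Gamma_range => -[j _ <-]; exists j.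
  by split; apply: rangeP; right; exists i; [left|right].
(* The estimate is first obtained with [gam]; [dbl] then passes to [2 * gam], the bracket being
   nonnegative. *)
have main x : exists2 xs, opt_solution A M y tau phi xs & l2norm (x - xs) <=
    delta + gam * (nhat%:R * Num.max (phires x - tau) 0 + 2 * best_kterm_err k x
                   + c * tau + c * phires x).
  have [z [zb zmin zx]] :=
    relaxed_error_bound y rankA tau_gt0 phi_norm Gamma_le rankM box rsp x.
  (* Here [z] is shown to lie in the relaxed set: its l1 norm is a lower bound over the feasible
     points, hence at most [opt_value], and dividing the relaxed constraints by [tau] gives
     membership in the polytope. *)
  have [xs xsS xsz] : exists2 xs, sol_set A M y tau phi xs & l2norm (xs - z) <= delta.
    apply: (hausdorff_nearest rankA tau_gt0 phi_norm j0_close); split.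
      apply: lb_le_inf; last by move=> _ [u uf <-]; exact: zmin.
      have [xo [_ xof]] := sol_set_nonempty M y rankA tau_gt0 phi_norm.
      by exists (l1norm xo), xo.
    apply: Qpoly_halfspaces => a; rewrite -Gamma_range => -[j _ <-].
    rewrite dotvZr ler_pdivrMl// mulr1 -subr_le0 -relax_slack cV_subE subr_le0; exact: zb.
  exists xs; first exact: sol_set_opt.
  have -> : x - xs = (x - z) + (z - xs) by rewrite addrA subrK.
  rewrite (le_trans (l2norm_triangle _ _))// addrC lerD//.
  by rewrite -opprB (sublinearN _ (sublinear_l2norm R n)).
have gam0 : 0 <= gam by exact: robinson_sigma_ge0.
have c0 : 0 <= c by exact: cst_c_ge0.
have phi0 x : 0 <= phires x by exact: (sublinear_ge0 _ (is_norm_sublinear phi_norm)).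
have dbl s : 0 <= s -> delta + gam * s <= delta + 2 * gam * s.
  by move=> s0; rewrite lerD2l -mulrA ler_peMl ?mulr_ge0// ler1n.
split=> [x|x xf].
  have [xs xsO xsx] := main x; exists xs => //; apply: le_trans xsx (dbl _ _).
  have err0 := best_kterm_err_ge0 k x.
  have max0 : 0 <= Num.max (phires x - tau) 0 by rewrite le_max lexx orbT.
  by rewrite !addr_ge0// ?mulr_ge0// ltW.
have err0 := best_kterm_err_ge0 k x.
have [xs xsO xsx] := main x; exists xs => //.
have xtau : phires x <= tau by exact: xf.
(* For a feasible [x] the violation term vanishes, and phi <= tau merges the two c-terms. *)
rewrite (max_idPr _) ?subr_le0// mulr0 add0r in xsx; split.
  by apply: le_trans xsx (dbl _ _); rewrite !addr_ge0// ?mulr_ge0// ltW.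
rewrite lerD2l (_ : 4 * gam * _ = 2 * gam * (2 * (best_kterm_err k x + c * tau))); last by ring.
rewrite ler_wpM2l ?mulr_ge0//; have : c * phires x <= c * tau by rewrite ler_wpM2l.
by lra.
Qed.
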